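(* Let $d\ge1$, $0<\alpha<1$ and $\beta>1$. Let $\{X_{\mathbf k},\mathbf k\in\mathbb Z_+^d\}$ be i.i.d. copies of $X$ with $\mathbb EX=0$, $\operatorname{Var}X=\sigma^2<\infty$ and $\mathbb E\big(|X|^{2/\alpha}(\log^+|X|)^{d-1-1/\alpha}\big)<\infty$. For $i\ge1$ let $\mathbf n_i=(\lfloor i^{\beta/(1-\alpha)}\rfloor,\dots,\lfloor i^{\beta/(1-\alpha)}\rfloor)\in\mathbb Z_+^d$ (the diagonal points). Then $$\limsup_{i\to\infty}\frac{T_{\mathbf n_i,\mathbf n_i+\mathbf n_i^\alpha}}{\sqrt{2|\mathbf n_i|^\alpha\log|\mathbf n_i|}}=\sigma\sqrt{\frac{1-\alpha}{d\beta}},\qquad\liminf_{i\to\infty}\frac{T_{\mathbf n_i,\mathbf n_i+\mathbf n_i^\alpha}}{\sqrt{2|\mathbf n_i|^\alpha\log|\mathbf n_i|}}=-\sigma\sqrt{\frac{1-\alpha}{d\beta}}\quad\text{a.s.}$$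
   Context: $\mathbb Z_+^d$ is the set of $d$-tuples of positive integers. $|\mathbf n|=\prod_{k=1}^d n_k$. $\mathbf n^\alpha=(\lfloor n_1^\alpha\rfloor,\dots,\lfloor n_d^\alpha\rfloor)$. For $\mathbf k\in\mathbb Z_{\ge0}^d$, $T_{\mathbf n,\mathbf n+\mathbf k}=\sum X_{\mathbf j}$ over all $\mathbf j\in\mathbb Z_+^d$ with $n_i<j_i\le n_i+k_i$ for every $i$. $\log^+x=\max\{\log x,1\}$. *)

(* Defs.v *)
From HB Require Import structures.
From mathcomp Require Import all_boot all_order all_algebra.
From mathcomp Require Import all_classical all_reals all_analysis.
Set Implicit Arguments. Unset Strict Implicit. Unset Printing Implicit Defensive.
Import Order.TTheory GRing.Theory Num.Theory.
Import numFieldNormedType.Exports.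
Local Open Scope classical_set_scope.
Local Open Scope ring_scope.

(* Multi-indices in Z^d are represented as finite functions 'I_d -> nat;
   Z_+^d is the subset of those with all coordinates positive. *)
Definition idx (d : nat) := {ffun 'I_d -> nat}.

Definition pos_index (d : nat) (k : idx d) : bool := [forall i, (0 < k i)%N].

Definition card_idx (d : nat) (n : idx d) : nat := (\prod_(i < d) n i)%N.

Definition pow_idx {R : realType} (d : nat) (n : idx d) (a : R) : idx d :=
  [ffun i => Num.truncn ((n i)%:R `^ a)].

Definition logp {R : realType} (x : R) : R := Num.max (ln x) 1.

(* T_{n, n+k} = sum of X_j over j with n_i < j_i <= n_i + k_i for all i.
   Writing j_i = n_i + 1 + t_i with 0 <= t_i < k_i. *)
Definition Tsum {T : Type} {R : realType} (d : nat) (X : idx d -> T -> R)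
    (n k : idx d) (w : T) : R :=
  \sum_(t : {ffun 'I_d -> 'I_(\max_(i < d) k i)} | [forall i, (t i < k i)%N])
     X [ffun i => (n i + (t i).+1)%N] w.

Definition iid_copies {dt : measure_display} {T : measurableType dt}
    {R : realType} (P : probability T R) (d : nat)
    (X : idx d -> {RV P >-> R}) (X0 : {RV P >-> R}) : Prop :=
  (forall k : idx d, pos_index k ->
     forall B : set R, measurable B -> P (X k @^-1` B) = P (X0 @^-1` B)) /\
  (forall s : seq (idx d), uniq s -> all (@pos_index d) s ->
     forall B : idx d -> set R, (forall k, measurable (B k)) ->
       P (\bigcap_(k in [set k | k \in s]) (X k @^-1` B k)) =
       (\prod_(k <- s) P (X k @^-1` B k))%E).

Definition diag_pt {R : realType} (d : nat) (a b : R) (i : nat) : idx d :=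
  [ffun _ => Num.truncn ((i%:R : R) `^ (b / (1 - a)))].

Definition ratioT {T : Type} {R : realType} (d : nat) (X : idx d -> T -> R)
    (a b : R) (i : nat) (w : T) : R :=
  let n := diag_pt d a b i in
  Tsum X n (pow_idx n a) w /
    Num.sqrt (2 * ((card_idx n)%:R `^ a) * ln (card_idx n)%:R).

(* Main.v *)
Require Import Defs.
From HB Require Import structures.
From mathcomp Require Import all_boot all_order all_algebra.
From mathcomp Require Import all_classical all_reals all_analysis.
From mathcomp Require Import measurable_realfun ring lra.
Import Order.TTheory GRing.Theory Num.Theory.
Import numFieldNormedType.Exports.
Import HBNNSimple.
Local Open Scope classical_set_scope.
Local Open Scope ring_scope.

(** The window at the i-th diagonal point has N_i ~ i^g points, where
    g = alpha beta d / (1 - alpha), and since beta > 1 the windows are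
    eventually disjoint, so their sums S_i are independent. The denominator is
    asymptotic to sqrt (2 N_i log i) divided by sqrt ((1 - alpha) / (d beta)),
    so it must be shown that limsup S_i / sqrt (2 N_i log i) = sigma.
    The moment assumption gives E|X|^p < oo for some p > 2 + 2/g, and then the
    terms can be truncated at i^h with (1 + g)/p < h < g/2: almost surely only
    finitely many windows are affected, while the truncation level is so much
    smaller than sqrt (N_i / log i) that the Laplace transform of the
    truncated sum Z_i, normalised by sqrt (2 N_i log i), is Gaussian at speed
    y_i = 2 log i, i.e. E exp (th y_i Z_i) = exp (y_i (th^2 sigma^2/2 + o(1)))
    for every real th. Chernoff's bound makes P (Z_i >= t) summable for
    t > sigma. A tilting argument (mass of exp (th y_i Z_i) outside a window
    around its mean is negligible, by comparison with th + h and th - h)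
    bounds P (Z_i > sigma - 2 delta) below by 1/(2i). The two Borel-Cantelli
    lemmas conclude; the liminf is obtained from the field - X. *)

(** * Independence *)

Section indep.
Context {R : realType} {dt : measure_display} {T : measurableType dt}.
Variable (P : probability T R).
Local Open Scope ereal_scope.

(** Measure-theoretic induction: the identity on indicators extends to simple functions by
    linearity, then to [f] by monotone convergence. In the application [W] is the product of the
    factors other than [f (X w)] and [c] is its integral. *)
Lemma ge0_integral_weight (X : {RV P >-> R}) (W : T -> R) (c : \bar R) (f : R -> R) :
  measurable_fun setT W -> (forall w, 0 <= W w)%R -> c \is a fin_num ->
  (forall B : set R, measurable B ->
    \int[P]_w (\1_B (X w) * W w)%:E = c * P (X @^-1` B)) ->
  measurable_fun setT f -> (forall x, 0 <= f x)%R ->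
  \int[P]_w (f (X w) * W w)%:E = c * \int[P]_w (f (X w))%:E.
Proof.
move=> mW W0 cfin cW mf f0.
have mfE : measurable_fun setT (EFin \o f) by exact/measurable_EFinP.
pose h := nnsfun_approx measurableT mfE.
have mhX n : measurable_fun setT (fun w => h n (X w)) by exact: measurableT_comp.
have mhXW n : measurable_fun setT (fun w => h n (X w) * W w)%R.
  by apply: measurable_funM.
have hh x : (h n x)%:E @[n --> \oo] --> (f x)%:E.
  by apply: cvg_nnsfun_approx => // y _; rewrite lee_fin.
have ndh x : {homo (fun n => h n x) : a b / (a <= b)%N >-> (a <= b)%R}.
  by move=> a b ab; exact/lefP/nd_nnsfun_approx.
have hE n : \int[P]_w (h n (X w) * W w)%:E = c * \int[P]_w (h n (X w))%:E.
  (* [F] is left generic because the decomposition of [h n] along its finitely many values is used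
     with [W] on one side and with the constant 1 on the other. *)
  have key (F : T -> R) : \int[P]_w (h n (X w) * F w)%:E =
     \int[P]_w (\sum_(y \in range (h n)) (y * (\1_(h n @^-1` [set y]) (X w) * F w))%:E).
    apply: eq_integral => w _.
    rewrite fsumEFin// [in LHS](fimfunE (h n) (X w)); congr EFin.
    rewrite !fsbig_finite//= mulr_suml; apply: eq_bigr => y _.
    by rewrite mulrA.
  have m1 y : measurable_fun setT (fun w => \1_(h n @^-1` [set y]) (X w) : R)%R.
    by apply: measurableT_comp => //; apply: measurable_indic.
  rewrite key.
  have -> : \int[P]_w (h n (X w))%:E = \int[P]_w (h n (X w) * cst 1%R w)%:E.
    by apply: eq_integral => w _; rewrite /cst mulr1.
  rewrite key ge0_integral_fsum//; last 2 first.
  - move=> y; apply/measurable_EFinP; apply: measurable_funM => //.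
    by apply: measurable_funM => //.
  - move=> y w _; rewrite lee_fin indicE.
    case: (boolP (X w \in h n @^-1` [set y])) => [|_]; last by rewrite mul0r mulr0.
    by rewrite inE/= => <-; rewrite mul1r mulr_ge0.
  rewrite ge0_integral_fsum//; last 2 first.
  - move=> y; apply/measurable_EFinP; apply: measurable_funM => //.
    by apply: measurable_funM => //.
  - move=> y w _; rewrite lee_fin indicE.
    case: (boolP (X w \in h n @^-1` [set y])) => [|_]; last by rewrite mul0r mulr0.
    by rewrite inE/= => <-; rewrite mul1r mulr_ge0.
  rewrite ge0_mule_fsumr; last first.
    move=> y; apply: integral_ge0 => w _; rewrite lee_fin indicE.
    case: (boolP (X w \in h n @^-1` [set y])) => [|_]; last by rewrite mul0r mulr0.
    by rewrite inE/= => <-; rewrite mul1r mulr_ge0.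
  apply: eq_fsbigr => y /[!inE] -[x _ <-].
  under eq_integral do rewrite EFinM.
  rewrite ge0_integralZl_EFin//; last 2 first.
  - by move=> w _; rewrite lee_fin mulr_ge0// indicE.
  - by apply/measurable_EFinP; apply: measurable_funM.
  rewrite cW; last by [].
  under [in RHS]eq_integral do rewrite EFinM.
  rewrite ge0_integralZl_EFin//; last 2 first.
  - by move=> w _; rewrite lee_fin mulr_ge0// indicE.
  - by apply/measurable_EFinP; apply: measurable_funM.
  rewrite muleCA; congr (_ * (_ * _)).
  under eq_integral do rewrite /cst mulr1.
  rewrite -[X in P X]setIT -integral_indic//; last first.
    rewrite -[X in measurable X]setTI; exact: measurable_funP.
have L1 : \int[P]_w (h n (X w) * W w)%:E @[n --> \oo] --> \int[P]_w (f (X w) * W w)%:E.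
  have -> : \int[P]_w (f (X w) * W w)%:E = \int[P]_w (limn (fun n => (h n (X w) * W w)%:E)).
    apply: eq_integral => w _; apply/esym/cvg_lim => //.
    under eq_fun do rewrite EFinM; rewrite EFinM; apply: cvgeZr => //; exact: hh.
  apply: cvg_monotone_convergence => //.
  - by move=> n; apply/measurable_EFinP.
  - by move=> n w _; rewrite lee_fin mulr_ge0.
  - by move=> w _ a b ab; rewrite lee_fin ler_wpM2r//; exact: ndh.
have L2 : \int[P]_w (h n (X w))%:E @[n --> \oo] --> \int[P]_w (f (X w))%:E.
  have -> : \int[P]_w (f (X w))%:E = \int[P]_w (limn (fun n => (h n (X w))%:E)).
    by apply: eq_integral => w _; apply/esym/cvg_lim => //; exact: hh.
  apply: cvg_monotone_convergence => //.
  - by move=> n; apply/measurable_EFinP.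
  - by move=> n w _; rewrite lee_fin.
  - by move=> w _ a b ab; rewrite lee_fin; exact: ndh.

transitivity (limn (fun n => c * \int[P]_w (h n (X w))%:E)).
  by apply/esym/cvg_lim => //; under eq_fun do rewrite -hE.
apply/cvg_lim => //.
exact: cvgeZl.
Qed.

Lemma measurable_RV_preimage (X : {RV P >-> R}) (B : set R) :
  measurable B -> measurable (X @^-1` B).
Proof. by move=> mB; rewrite -[X in measurable X]setTI; exact: measurable_funP. Qed.

Definition cylinder {I : eqType} (X : I -> {RV P >-> R}) (s : seq I)
    (B : I -> set R) : set T :=
  \bigcap_(k in [set k | k \in s]) (X k @^-1` B k).

(** A pi-system generating the sigma-algebra of the variables [X k], [k] in [s]. *)
Definition cylinders {I : eqType} (X : I -> {RV P >-> R}) (s : seq I) : set (set T) :=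
  [set C | exists2 B : I -> set R, (forall k, measurable (B k)) & C = cylinder X s B].

(** The predicate [D] restricts independence to the indices where the field is controlled, later the
    positive multi-indices. *)
Definition rect_independent {I : eqType} (X : I -> {RV P >-> R}) (D : pred I) :=
  forall s : seq I, uniq s -> all D s ->
  forall B : I -> set R, (forall k, measurable (B k)) ->
    P (cylinder X s B) = \prod_(k <- s) P (X k @^-1` B k).

Section rect.
Context {I : eqType} (X : I -> {RV P >-> R}) (D : pred I).
Hypothesis indX : rect_independent X D.

Lemma measurable_cylinder (s : seq I) (B : I -> set R) :
  (forall k, measurable (B k)) -> measurable (cylinder X s B).
Proof.
move=> mB; apply: fin_bigcap_measurable; first exact: finite_seq.
by move=> k _; exact: measurable_RV_preimage.
Qed.

Lemma indic_cylinder (s : seq I) (B : I -> set R) w :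
  (\1_(cylinder X s B) w = \prod_(k <- s) \1_(B k) (X k w) :> R)%R.
Proof.
elim: s => [|k s IH].
  by rewrite big_nil indicE mem_set// => k /=; rewrite in_nil.
rewrite big_cons -IH !indicE -natrM mulnb; congr (_%:R); congr nat_of_bool.
apply/idP/andP => [/set_mem h|[/set_mem h1 /set_mem h2]].
  split; apply/mem_set; first by apply: (h k); rewrite /= mem_head.
  by move=> j /= js; apply: h; rewrite /= in_cons js orbT.
by apply/mem_set => j /=; rewrite in_cons => /orP[/eqP ->//|]; exact: h2.
Qed.

(* The factors are replaced one at a time, indicators serving as placeholders
   for the factors not yet treated. *)
Let integral_prod_mixed (f : I -> R -> R) (s1 s2 : seq I) (B : I -> set R) :
  (forall k, measurable_fun setT (f k)) -> (forall k x, 0 <= f k x)%R ->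
  (forall k, \int[P]_w (f k (X k w))%:E < +oo) ->
  (forall k, measurable (B k)) ->
  uniq (s1 ++ s2) -> all D (s1 ++ s2) ->
  \int[P]_w ((\prod_(k <- s1) f k (X k w)) * (\prod_(k <- s2) \1_(B k) (X k w)))%:E
  = (\prod_(k <- s1) \int[P]_w (f k (X k w))%:E) * \prod_(k <- s2) P (X k @^-1` B k).
Proof.
move=> mf f0 foo; elim: s1 s2 B => [|k0 s1 IH] s2 B mB us Ds.
  rewrite big_nil mul1e -indX//.
  rewrite -[X in P X]setIT -integral_indic//; last exact: measurable_cylinder.
  by apply: eq_integral => w _; rewrite big_nil mul1r indic_cylinder.
move: us Ds; rewrite cat_cons /= => /andP[k0s us] /andP[Dk0 Ds].
have k0s2 : k0 \notin s2 by move: k0s; rewrite mem_cat negb_or => /andP[].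
pose W w : R := ((\prod_(k <- s1) f k (X k w)) * (\prod_(k <- s2) \1_(B k) (X k w)))%R.
rewrite big_cons -muleA -IH// muleC.
have mW : measurable_fun setT W.
  rewrite /W; apply: measurable_funM.
    by apply: measurable_prod => k _; apply: measurableT_comp.
  under eq_fun do rewrite -indic_cylinder.
  by apply: measurable_indic; exact: measurable_cylinder.
have W0 w : (0 <= W w)%R.
  by rewrite mulr_ge0// prodr_ge0// => k _; rewrite indicE.
have E0 k : 0 <= \int[P]_w (f k (X k w))%:E.
  by apply: integral_ge0 => w _; rewrite lee_fin.
transitivity (\int[P]_w (f k0 (X k0 w) * W w)%:E).
  by apply: eq_integral => w _; rewrite big_cons -mulrA.
apply: ge0_integral_weight => //.
  rewrite IH//; apply: fin_numM; rewrite prode_fin_num// => k _.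
    by rewrite ge0_fin_numE.
  exact/fin_num_measure/measurable_RV_preimage.
(* On the indicator of [C] the required identity is the induction hypothesis with [k0] moved among
   the placeholders, carrying the set [C]. *)
move=> C mC; pose B' k := if k == k0 then C else B k.
have B'E k : k \in s2 -> B' k = B k.
  by rewrite /B'; case: eqP => // -> ks; rewrite ks in k0s2.
have B'k0 : B' k0 = C by rewrite /B' eqxx.
have mB' k : measurable (B' k) by rewrite /B'; case: ifP.
have := IH (k0 :: s2) B' mB'.
rewrite (perm_uniq (_ : perm_eq _ (k0 :: s1 ++ s2))); last by rewrite -cat1s perm_catCA.
rewrite (perm_all _ (_ : perm_eq _ (k0 :: s1 ++ s2))); last by rewrite -cat1s perm_catCA.
rewrite /= k0s us Dk0 Ds => /(_ isT isT).
rewrite big_cons B'k0 muleCA muleC.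
have -> : \prod_(k <- s2) P (X k @^-1` B' k) = \prod_(k <- s2) P (X k @^-1` B k).
  by apply: eq_big_seq => k ks /=; rewrite B'E.
rewrite -IH// => <-.
apply: eq_integral => w _; rewrite big_cons B'k0 mulrCA.
by congr ((_ * (_ * _))%:E); apply: eq_big_seq => k ks /=; rewrite B'E.
Qed.

Lemma integral_prod_indep (f : I -> R -> R) (s : seq I) :
  (forall k, measurable_fun setT (f k)) -> (forall k x, 0 <= f k x)%R ->
  (forall k, \int[P]_w (f k (X k w))%:E < +oo) ->
  uniq s -> all D s ->
  \int[P]_w (\prod_(k <- s) f k (X k w))%:E
  = \prod_(k <- s) \int[P]_w (f k (X k w))%:E.
Proof.
move=> mf f0 foo us Ds.
have := @integral_prod_mixed f s [::] (fun=> setT) mf f0 foo.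
rewrite cats0 big_nil mule1 => <-//.
by apply: eq_integral => w _; rewrite big_nil mulr1.
Qed.

(** Uniqueness of finite measures on a pi-system: cylinders over [J] are stable under intersection
    and contain the whole space. *)
Lemma measure_agree_cylinder (J : seq I) (m1 m2 : {measure set T -> \bar R}) A :
  m1 setT < +oo ->
  (forall B, (forall k, measurable (B k)) -> m1 (cylinder X J B) = m2 (cylinder X J B)) ->
  <<s cylinders X J >> A ->
  m1 A = m2 A.
Proof.
move=> m1oo m12; set G := cylinders X J.
have GT : G setT.
  by exists (fun=> setT) => //; apply/esym/seteqP; split.
apply: (@g_sigma_algebra_measure_unique _ _ _ G _ (fun=> setT)) => //.
- by move=> _ [B mB ->]; exact: measurable_cylinder.
- by apply/seteqP; split => // x _; exists 0%N.
- move=> _ _ [B mB ->] [C mC ->]; exists (fun k => B k `&` C k).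
    by move=> k; exact: measurableI.
  by apply/seteqP; split => [w [h1 h2] k /= kJ|w h]; [split; [exact: h1|exact: h2]|split => k /= kJ; have [] := h k kJ].
- by move=> _ [B mB ->]; exact: m12.
Qed.

(** The extra cylinder over [t] makes the induction work. When a block is peeled off, its event is
    first replaced by a cylinder, which joins the cylinder over [t]; uniqueness of measures then
    restores the event. *)
Lemma blocks_independent (K : eqType) (J : K -> seq I) (E : K -> set T) (l : seq K)
   (t : seq I) (B : I -> set R) :
  (forall i, measurable (E i)) ->
  (forall i, <<s cylinders X (J i) >> (E i)) ->
  (forall k, measurable (B k)) ->
  uniq (flatten (map J l) ++ t) -> all D (flatten (map J l) ++ t) ->
  P (\big[setI/setT]_(i <- l) E i `&` cylinder X t B) =
  (\prod_(i <- l) P (E i)) * P (cylinder X t B).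
Proof.
move=> mE sE; elim: l t B => [|i l IH] t B mB us Ds; first by rewrite !big_nil setTI mul1e.
rewrite !big_cons -setIA -muleA.
have [ult Dlt] : uniq (flatten (map J l) ++ t) /\ all D (flatten (map J l) ++ t).
  move: us Ds; rewrite /= -catA cat_uniq all_cat => /andP[_ /andP[_ ->]].
  by case/andP=> _ ->.
rewrite -IH//; set A := _ `&` cylinder X t B.
have mA : measurable A.
  apply: measurableI; last exact: measurable_cylinder.
  by apply: bigsetI_measurable => j _.
have PA : P A \is a fin_num by exact: fin_num_measure.
(* As functions of [E i] the two sides are finite measures: [P] restricted to [A], and [P] scaled by
   the mass of [A]. *)
pose m1 := mrestr P mA.
pose m2 := mscale (NngNum (fine_ge0 (measure_ge0 P A))) P.
rewrite muleC -[P A](fineK PA).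
apply: (@measure_agree_cylinder (J i) m1 m2) => //.
  by rewrite /m1 /= /mrestr setTI -ge0_fin_numE.
move=> C mC.
rewrite /m1 /m2 /= /mrestr /mscale /= fineK//.
(* Since [J i] and [t] are disjoint, their cylinders merge into one over [J i ++ t], to which the
   induction hypothesis applies. *)
pose B' k := if k \in J i then C k else B k.
have mB' k : measurable (B' k) by rewrite /B'; case: ifP.
have tJ k : k \in t -> k \notin J i.
  move: us; rewrite /= -catA cat_uniq => /and3P[_ /hasPn h _] kt.
  by apply: h; rewrite mem_cat kt orbT.
have cylE : cylinder X (J i) C `&` A = \big[setI/setT]_(i <- l) E i `&` cylinder X (J i ++ t) B'.
  apply/seteqP; split => w; rewrite /A.
    move=> [h1 [h2 h3]]; split => // k /=; rewrite mem_cat /B'.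
    by case: ifPn => [kJ _|_ /= kt]; [exact: h1|exact: h3].
  move=> [h1 h2]; split => [k /= kJ|].
    by have := h2 k; rewrite /= mem_cat kJ /B' kJ => /(_ isT).
  split => // k /= kt; have := h2 k; rewrite /= mem_cat kt orbT /B' => /(_ isT).
  by rewrite (negbTE (tJ _ kt)).
have [uJt DJt] : uniq (J i ++ t) /\ all D (J i ++ t).
  move: us Ds; rewrite /= -catA => us Ds; split.
    by move: us; rewrite (perm_uniq (permEl (perm_catCA _ _ _))) cat_uniq => /and3P[].
  by move: Ds; rewrite (perm_all _ (permEl (perm_catCA _ _ _))) all_cat => /andP[].
rewrite cylE IH//; last 2 first.
- by rewrite (perm_uniq (permEl (perm_catCA _ _ _))) catA.
- by rewrite (perm_all _ (permEl (perm_catCA _ _ _))) catA.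
rewrite (IH t B mB ult Dlt) -muleA; congr (_ * _).
move: (uJt) (DJt); rewrite cat_uniq all_cat => /and3P[uJ _ ut] /andP[DJ Dt].
rewrite !indX// big_cat muleC; congr (_ * _); apply: eq_big_seq => k ks; rewrite /B'.
  by rewrite ks.
by rewrite (negbTE (tJ _ ks)).
Qed.

End rect.
End indep.

(** * Truncation *)

Section real_estimates.
Context {R : realType}.

(** From degree 3 on, the exponential series is dominated by a geometric series of ratio 1/2,
    because [2 ^ n.+1 <= (n + 3)!]. *)
Lemma expR_taylor2 (y : R) : `|y| <= 1 ->
  `|expR y - (1 + y + y ^+ 2 / 2)| <= `|y| ^+ 3.
Proof.
move=> y1; set c := 1 + y + _.
have step n : `|series (exp_coeff y) (n + 3)%N - c| <= `|y| ^+ 3 * (1 - 2 ^- n).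
  elim: n => [|n IH].
    rewrite /series /= add0n big_mkord !big_ord_recr big_ord0 /= /exp_coeff /=.
    rewrite add0r ?expr0 ?expr1 /bump /= ?divr1.
    by rewrite subrr normr0 invr1 subrr mulr0.
  rewrite addSn seriesSr.
  rewrite addrAC; apply: (le_trans (ler_normD _ _)).
  have F : (2 ^ n.+1 <= (n + 3)`!)%N.
    elim: n {IH} => [//|n IH]; rewrite expnS addSn factS leq_mul// addnC //.
  have h : `|exp_coeff y (n + 3)%N| <= `|y| ^+ 3 * 2 ^- n.+1.
    rewrite /exp_coeff /= normrM normrX normfV normr_nat.
    rewrite addnC exprD -mulrA ler_wpM2l//.
    have : `|y| ^+ n <= 1 by rewrite exprn_ile1.
    move=> yn; rewrite -[leRHS]mul1r ler_pM//.
    by rewrite lef_pV2 ?posrE ?exprn_gt0 ?ltr0n ?fact_gt0// -natrX ler_nat addnC.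
  apply: (le_trans (lerD IH h)).
  rewrite -mulrDr ler_wpM2l// exprS invfM; lra.
have cv : (fun n => `|series (exp_coeff y) (n + 3)%N - c|) @ \oo --> `|expR y - c|.
  apply: cvg_norm; apply: cvgB; last exact: cvg_cst.
  by rewrite (cvg_shiftn 3); exact: is_cvg_series_exp_coeff.
rewrite -(cvg_lim _ cv)//.
apply: limr_le; first by apply/cvg_ex; eexists; exact: cv.
apply: nearW => n; apply: (le_trans (step n)).
by rewrite ler_piMr ?exprn_ge0// gerBl invr_ge0 exprn_ge0.
Qed.

(** The bound [ln (1 + x) <= x] at [x = - r / (1 + r)] gives [ln (1 + r) >= r / (1 + r)], and
    [1 + r >= 1/2] does the rest. *)
Lemma ln1D_ge (r : R) : - (1 / 2) <= r -> r - 2 * r ^+ 2 <= ln (1 + r).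
Proof.
move=> r2; have r1 : 0 < 1 + r by lra.
have h : ln (1 + r) = - ln (1 - r / (1 + r)).
  rewrite -lnV ?posrE; last by rewrite (_ : 1 - _ = (1 + r)^-1) ?invr_gt0//; field; lra.
  by congr ln; field; rewrite addrK; apply/andP; split; lra.
rewrite h.
have : ln (1 - r / (1 + r)) <= - (r / (1 + r)).
  apply: le_ln1Dx; rewrite ltrN2 ltr_pdivrMr//; lra.
move=> h2; suff : r - 2 * r ^+ 2 <= r / (1 + r) by lra.
rewrite ler_pdivlMr//; nra.
Qed.

Definition trunc (L x : R) : R := if `|x| <= L then x else 0.

Lemma norm_trunc_leL (L x : R) : 0 <= L -> `|trunc L x| <= L.
Proof. by rewrite /trunc; case: ifP; rewrite ?normr0. Qed.

Lemma measurable_trunc (L : R) : measurable_fun setT (trunc L).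
Proof.
apply: measurable_fun_ifT => //.
by apply: measurable_fun_ler => //; exact: measurableT_comp.
Qed.

(** Where the difference does not vanish, [|x| > L], so the factor [(|x| / L) ^ (p - 1)] is at least
    1. *)
Lemma norm_sub_trunc_le (L x p : R) : 0 < L -> 1 < p ->
  `|x - trunc L x| <= L `^ (1 - p) * `|x| `^ p.
Proof.
move=> L0 p1; rewrite /trunc; case: (leP `|x| L) => xL.
  by rewrite subrr normr0 mulr_ge0 ?powR_ge0.
have x0 : 0 < `|x| by exact: lt_trans xL.
rewrite subr0 -(mulr_powRB1 (normr_ge0 x)) ?(lt_trans _ p1)// mulrCA ler_peMr//.
rewrite -opprB powRN mulrC ler_pdivlMr ?powR_gt0// mul1r.
by apply: ge0_ler_powR; rewrite ?nnegrE ?subr_ge0// ltW.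
Qed.

Lemma sqr_sub_trunc_le (L x p : R) : 0 < L -> 2 < p ->
  0 <= x ^+ 2 - (trunc L x) ^+ 2 <= L `^ (2 - p) * `|x| `^ p.
Proof.
move=> L0 p1; rewrite /trunc; case: (leP `|x| L) => xL.
  by rewrite subrr lexx mulr_ge0 ?powR_ge0.
have x0 : 0 < `|x| by exact: lt_trans xL.
rewrite expr0n subr0 sqr_ge0 /=.
have -> : `|x| `^ p = x ^+ 2 * `|x| `^ (p - 2).
  rewrite -(real_normK (num_real x)) expr2 -mulrA.
  have -> : p - 2 = p - 1 - 1 by lra.
  by rewrite !mulr_powRB1//; lra.
rewrite mulrCA ler_peMr ?sqr_ge0//.
rewrite -opprB powRN mulrC ler_pdivlMr ?powR_gt0// mul1r.
by apply: ge0_ler_powR; rewrite ?nnegrE ?subr_ge0// ltW.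
Qed.

End real_estimates.

Section truncated_moments.
Context {R : realType} {dt : measure_display} {T : measurableType dt}.
Variable (P : probability T R).
Variables (X : {RV P >-> R}) (sigma p : R).
Hypothesis p2 : 2 < p.
Hypothesis iX : P.-integrable setT (EFin \o X).
Hypothesis iX2 : P.-integrable setT (EFin \o (fun w => X w ^+ 2)).
Hypothesis iXp : P.-integrable setT (EFin \o (fun w => `|X w| `^ p)).
Hypothesis EX0 : \int[P]_w X w = 0.
Hypothesis EX2 : \int[P]_w (X w ^+ 2) = sigma ^+ 2.
Let M := \int[P]_w (`|X w| `^ p).

Lemma bounded_RV_integrable (f : R -> R) (C : R) :
  measurable_fun setT f -> (forall x, `|f x| <= C) ->
  P.-integrable setT (EFin \o (fun w => f (X w))).
Proof.
move=> mf fC; apply: measurable_bounded_integrable => //.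
- by rewrite ltey_eq fin_num_measure.
- exact: measurableT_comp.
- by exists C; split; [exact: num_real|move=> C' CC' w _ /=; exact: le_trans (fC _) (ltW CC')].
Qed.

Lemma integrable_trunc (L : R) : 0 <= L -> P.-integrable setT (EFin \o (fun w => trunc L (X w))).
Proof.
move=> L0; apply: (@bounded_RV_integrable (trunc L) L); first exact: measurable_trunc.
by move=> x; exact: norm_trunc_leL.
Qed.

Lemma integrable_trunc2 (L : R) : 0 <= L ->
  P.-integrable setT (EFin \o (fun w => trunc L (X w) ^+ 2)).
Proof.
move=> L0; apply: (@bounded_RV_integrable (fun x => trunc L x ^+ 2) (L ^+ 2)).
  by apply: measurable_funX; exact: measurable_trunc.
by move=> x; rewrite normrX lerXn2r ?nnegrE//; exact: norm_trunc_leL.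
Qed.

Lemma moment_ge0 : 0 <= M.
Proof. by apply: Rintegral_ge0 => w _; exact: powR_ge0. Qed.

(** As [X] is centred, the truncated mean is minus the mean of the part cut off. *)
Lemma mean_trunc_le (L : R) : 0 < L -> `|\int[P]_w trunc L (X w)| <= M * L `^ (1 - p).
Proof.
move=> L0; have iT := integrable_trunc _ (ltW L0).
have iD : P.-integrable setT (EFin \o (fun w => X w - trunc L (X w))).
  by apply: eq_integrable (integrableB measurableT iX iT).
rewrite -normrN -[X in `|X|]add0r -EX0 -RintegralB//.
apply: le_trans.
  exact: le_normr_Rintegral iD.

rewrite mulrC -RintegralZl//; apply: le_Rintegral => //.
- exact: (integrable_norm iD).
- by apply: eq_integrable (integrableZl measurableT (L `^ (1 - p)) iXp).
- by move=> w _; apply: norm_sub_trunc_le => //; apply: lt_trans p2; rewrite ltr1n.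
Qed.

Lemma second_moment_trunc (L : R) : 0 < L ->
  sigma ^+ 2 - M * L `^ (2 - p) <= \int[P]_w (trunc L (X w) ^+ 2) <= sigma ^+ 2.
Proof.
move=> L0; have iT := integrable_trunc2 _ (ltW L0).
rewrite -EX2; apply/andP; split; last first.
  apply: le_Rintegral => // w _.
  by have /andP[] := sqr_sub_trunc_le _ (X w) _ L0 p2; rewrite subr_ge0.
rewrite lerBlDr -lerBlDl mulrC -RintegralZl// -RintegralB//.
apply: le_Rintegral => //.
- by apply: eq_integrable (integrableB measurableT iX2 iT).
- by apply: eq_integrable (integrableZl measurableT (L `^ (2 - p)) iXp).
- by move=> w _; have /andP[] := sqr_sub_trunc_le _ (X w) _ L0 p2.
Qed.

(** Markov's inequality at order [p]. *)
Lemma tail_trunc (L : R) : 0 < L ->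
  (P (X @^-1` [set x | (L < `|x|)%R]) <= (M * L `^ (- p))%R%:E)%E.
Proof.
move=> L0; set B := [set x | _].
have mB : measurable B.
  rewrite (_ : B = (fun x => `|x|) @^-1` `]L, +oo[); last first.
    by apply/seteqP; split => x; rewrite /B /= in_itv /= andbT.
  by rewrite -[X in measurable X]setTI; exact: normr_measurable.
rewrite -[X in P X]setIT -integral_indic//; last exact: measurable_RV_preimage.
rewrite mulrC -RintegralZl// fineK; last first.
  apply: integrable_fin_num => //.
  by apply: eq_integrable (integrableZl measurableT (L `^ (- p)) iXp).
apply: ge0_le_integral => //.
- by apply/measurable_EFinP/measurable_indic/measurable_RV_preimage.
- apply/measurable_EFinP; apply: measurable_funM => //.
  apply: (measurableT_comp (measurable_powR p)).
  exact: measurableT_comp.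
- move=> w _; rewrite lee_fin indicE; case: (boolP (w \in _)) => [/set_mem|_]; last first.
    by rewrite mulr_ge0 ?powR_ge0.
  rewrite /B /= => LX; rewrite powRN mulrC ler_pdivlMr ?powR_gt0// mul1r.
  by apply: ge0_ler_powR; rewrite ?nnegrE ?subr_ge0// ltW//; apply: lt_trans p2.
Qed.

Definition mgf_trunc (L u : R) := \int[P]_w expR (u * trunc L (X w)).

Lemma measurable_expR_trunc (L u : R) :
  measurable_fun setT (fun x : R => expR (u * trunc L x)).
Proof.
apply: measurableT_comp => //; apply: measurable_funM => //; exact: measurable_trunc.
Qed.

Lemma integrable_expR_trunc L u : 0 <= L ->
  P.-integrable setT (EFin \o (fun w => expR (u * trunc L (X w)))).
Proof.
move=> L0; apply: (@bounded_RV_integrable (fun x => expR (u * trunc L x)) (expR (`|u| * L))).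
  exact: measurable_expR_trunc.
move=> x; rewrite ger0_norm ?expR_ge0// ler_expR.
apply: (le_trans (ler_norm _)); rewrite normrM ler_wpM2l//; exact: norm_trunc_leL.
Qed.

(** The cubic remainder is paid for by [|trunc L x|^3 <= L * (trunc L x)^2]: only [p > 2] is
    assumed, so a third absolute moment may be infinite. *)
Lemma mgf_trunc_taylor (L u : R) : 0 < L -> `|u| * L <= 1 ->
  `|mgf_trunc L u - (1 + u * \int[P]_w trunc L (X w)
     + u ^+ 2 / 2 * \int[P]_w (trunc L (X w) ^+ 2))| <=
  `|u| ^+ 3 * L * \int[P]_w (trunc L (X w) ^+ 2).
Proof.
move=> L0 uL; have iT := integrable_trunc _ (ltW L0).
have iT2 := integrable_trunc2 _ (ltW L0).
have iE := integrable_expR_trunc _ u (ltW L0).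
have i1 : P.-integrable setT (EFin \o (fun=> 1 : R)).
  exact: finite_measure_integrable_cst.
have iuT : P.-integrable setT (EFin \o (fun w => u * trunc L (X w))).
  by apply: eq_integrable (integrableZl measurableT u iT).
have iuT2 : P.-integrable setT (EFin \o (fun w => u ^+ 2 / 2 * trunc L (X w) ^+ 2)).
  by apply: eq_integrable (integrableZl measurableT (u ^+ 2 / 2) iT2).
have i1u : P.-integrable setT (EFin \o (fun w => 1 + u * trunc L (X w))).
  by apply: eq_integrable (integrableD measurableT i1 iuT).
have iS : P.-integrable setT (EFin \o (fun w => 1 + u * trunc L (X w) + u ^+ 2 / 2 * trunc L (X w) ^+ 2)).
  by apply: eq_integrable (integrableD measurableT i1u iuT2).
have iD : P.-integrable setT (EFin \o (fun w => expR (u * trunc L (X w)) - (1 + u * trunc L (X w) + u ^+ 2 / 2 * trunc L (X w) ^+ 2))).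
  by apply: eq_integrable (integrableB measurableT iE iS).
have E1 : \int[P]_w (1 : R) = 1.
  by rewrite Rintegral_cst// mul1r -[RHS]/(fine 1%E) -(probability_setT P).
rewrite -!RintegralZl// -{1}E1 -RintegralD// -RintegralD// -RintegralB//.
apply: le_trans.
  exact: le_normr_Rintegral iD.
apply: le_Rintegral => //.
- exact: (integrable_norm iD).
- by apply: eq_integrable (integrableZl measurableT (`|u| ^+ 3 * L) iT2).
move=> w _; set t := trunc L (X w).
have tL : `|t| <= L by apply: norm_trunc_leL; exact: ltW.
have ut1 : `|u * t| <= 1.
  by rewrite normrM; apply: le_trans uL; rewrite ler_wpM2l.
rewrite (_ : u ^+ 2 / 2 * t ^+ 2 = (u * t) ^+ 2 / 2); last by rewrite exprMn mulrAC.
apply: (le_trans (expR_taylor2 _ ut1)).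
rewrite normrM exprMn -[leRHS]mulrA ler_wpM2l ?exprn_ge0//.
by rewrite exprS -(real_normK (num_real t)) ler_wpM2r// sqr_ge0.
Qed.

End truncated_moments.

(** * Large deviations from the limiting Laplace transform *)

Section large_deviations.
Context {R : realType} {dt : measure_display} {T : measurableType dt}.
Variable (P : probability T R).
Variables (Z : nat -> T -> R) (y : nat -> R) (psi : R -> nat -> R) (sigma : R).
Hypothesis mZ : forall i, measurable_fun setT (Z i).
Hypothesis yoo : y @ \oo --> +oo.
Hypothesis mgfZ : forall th, \forall i \near \oo,
  (\int[P]_w (expR (th * y i * Z i w))%:E = (expR (y i * psi th i))%:E)%E.
Hypothesis psi_cvg : forall th, psi th @ \oo --> th ^+ 2 * sigma ^+ 2 / 2.

Let measurable_exp th i : measurable_fun setT (fun w => expR (th * y i * Z i w)).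
Proof. by apply: measurableT_comp => //; apply: measurable_funM. Qed.

(** Chernoff's bound. The rate must exceed 1/2 because [y] will be [2 ln i], so that [exp (- k y)]
    is a summable power of [i]. *)
Lemma ldp_upper (t : R) : 0 <= sigma -> sigma < t ->
  exists2 k, 1 / 2 < k & \forall i \near \oo,
    (P [set w | (t <= Z i w)%R] <= (expR (- (k * y i)))%:E)%E.
Proof.
move=> s0 st; have t0 : 0 < t by exact: le_lt_trans st.
(* The choice [th = 1 / t] yields the rate [1 - sigma^2 / (2 t^2) > 1/2], and unlike the optimal
   [t / sigma^2] it also makes sense for [sigma = 0]. *)
set th := t^-1.
have th0 : 0 < th by rewrite invr_gt0.
set q := th ^+ 2 * sigma ^+ 2 / 2.
have q12 : q < 1 / 2.
  rewrite /q ltr_pM2r ?invr_gt0// /th exprVn mulrC ltr_pdivrMr ?exprn_gt0// mul1r.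
  by rewrite ltrXn2r// ?nnegrE ltW.
(* The midpoint of 1/2 and the limiting rate [1 - q]; the other half of the gap absorbs the error of
   [psi]. *)
exists ((1 / 2 + (1 - q)) / 2); first lra.
have e0 : 0 < (1 / 2 - q) / 2 by lra.
have /cvgrPdist_lt /(_ _ e0) H1 := psi_cvg th.
have /cvgryPge /(_ 0) H2 := yoo.
near=> i.
have y0 : 0 <= y i by near: i.
have psi_i : `|q - psi th i| < (1 / 2 - q) / 2 by near: i.
have mgf_i : (\int[P]_w (expR (th * y i * Z i w))%:E = (expR (y i * psi th i))%:E)%E.
  by near: i; exact: mgfZ.
have mE : measurable [set w | t <= Z i w].
  rewrite (_ : mkset _ = Z i @^-1` `[t, +oo[); last first.
    by apply/seteqP; split => w /=; rewrite in_itv /= andbT.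
  by rewrite -[X in measurable X]setTI; exact: mZ.
rewrite -[X in P X]setIT -integral_indic//.
apply: (@le_trans _ _ (\int[P]_w ((expR (- (y i)))%:E * (expR (th * y i * Z i w))%:E))%E).
  apply: ge0_le_integral => //.
  - exact/measurable_EFinP/measurable_indic.
  - by apply/measurable_EFinP; apply: measurable_funM.
  move=> w _; rewrite -EFinM lee_fin indicE -expRD.
  case: (boolP (w \in _)) => [/set_mem /= tZ|_]; last exact: expR_ge0.
  apply: (le_trans _ (expR_ge1Dx _)); rewrite lerDl addrC subr_ge0.
  by rewrite mulrAC ler_peMl// /th mulrC ler_pdivlMr// mul1r.
rewrite ge0_integralZl_EFin ?expR_ge0//; last first.
  exact/measurable_EFinP.
rewrite mgf_i -EFinM lee_fin -expRD ler_expR -lerBrDl.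
have := psi_i; rewrite ltr_distlC => /andP[_ h].
nra.
Unshelve. all: by end_near. Qed.

(** Tilted by [th], almost all the mass of [Z i] sits in the window from [sigma - 2 delta] to
    [sigma], where the tilting density is at most [c1]; this bounds the untilted probability from
    below. *)
Lemma ldp_lower (delta : R) : 0 < delta -> delta < sigma ->
  \forall i \near \oo,
    ((expR (- (y i / 2)) / 2)%:E <= P [set w | (sigma - 2 * delta < Z i w)%R])%E.
Proof.
move=> d0 ds; have s0 : 0 < sigma by exact: lt_trans ds.
(* The Gaussian tilted by [th] has mean [th sigma^2 = b], the centre of the window; the tilts
   [th + h] and [th - h] move the mean to its two ends. *)
set b := sigma - delta; set th := b / sigma ^+ 2; set h := delta / sigma ^+ 2.
(* A quarter of the cost [h^2 sigma^2 / 2] of leaving the window; each approximation by [psi] may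
   spend one [e]. *)
set e := delta ^+ 2 / sigma ^+ 2 / 8.
have s2 : 0 < sigma ^+ 2 by rewrite exprn_gt0.
have sn0 : sigma != 0 by rewrite gt_eqF.
have e0 : 0 < e by rewrite divr_gt0// divr_gt0// exprn_gt0.
have h0 : 0 < h by rewrite divr_gt0.
have /cvgrPdist_lt /(_ _ e0) H1 := psi_cvg th.
have /cvgrPdist_lt /(_ _ e0) H2 := psi_cvg (th + h).
have /cvgrPdist_lt /(_ _ e0) H3 := psi_cvg (th - h).
have /cvgryPge /(_ (3 / 2 / e)) H4 := yoo.
near=> i.
have y0 : 3 / 2 / e <= y i by near: i.
have yi0 : 0 <= y i by apply: le_trans y0; rewrite divr_ge0// ltW.
have psi1 : `|th ^+ 2 * sigma ^+ 2 / 2 - psi th i| < e by near: i.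
have psi2 : `|(th + h) ^+ 2 * sigma ^+ 2 / 2 - psi (th + h) i| < e by near: i.
have psi3 : `|(th - h) ^+ 2 * sigma ^+ 2 / 2 - psi (th - h) i| < e by near: i.
have mgf1 : (\int[P]_w (expR (th * y i * Z i w))%:E = (expR (y i * psi th i))%:E)%E.
  by near: i; exact: mgfZ.
have mgf2 : (\int[P]_w (expR ((th + h) * y i * Z i w))%:E = (expR (y i * psi (th + h) i))%:E)%E.
  by near: i; exact: mgfZ.
have mgf3 : (\int[P]_w (expR ((th - h) * y i * Z i w))%:E = (expR (y i * psi (th - h) i))%:E)%E.
  by near: i; exact: mgfZ.
set E := [set w | _ < _].
have mE : measurable E.
  rewrite (_ : E = Z i @^-1` `]sigma - 2 * delta, +oo[); last first.
    by apply/seteqP; split => w /=; rewrite /E /= in_itv /= andbT.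
  by rewrite -[X in measurable X]setTI; exact: mZ.
set c1 := expR (th * y i * sigma).
set c2 := expR (- (h * y i * sigma)).
set c3 := expR (h * y i * (sigma - 2 * delta)).
have hy0 : 0 <= h * y i by rewrite mulr_ge0// ltW.
(* Outside the window (sigma - 2 delta, sigma) a change of the tilting
   parameter by h dominates the exponential. *)
have split_exp w : expR (th * y i * Z i w) <= c1 * \1_E w
    + c2 * expR ((th + h) * y i * Z i w) + c3 * expR ((th - h) * y i * Z i w).
  rewrite /c1 /c2 /c3 indicE -!expRD.
  case: (boolP (w \in E)) => [_|/negP wE]; rewrite ?mulr1 ?mulr0 ?add0r; last first.
    have zle : Z i w <= sigma - 2 * delta.
      by rewrite leNgt; apply/negP => zlt; apply: wE; apply/mem_set.
    rewrite -[leLHS]add0r lerD ?expR_ge0// ler_expR.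
    suff : 0 <= h * y i * (sigma - 2 * delta - Z i w) by lra.
    by rewrite mulr_ge0// subr_ge0.
  have [zs|sz] := leP (Z i w) sigma.
    rewrite -addrA -[leLHS]addr0 lerD ?addr_ge0 ?expR_ge0// ler_expR.
    by rewrite ler_wpM2l// mulr_ge0// ltW// divr_gt0// subr_gt0.
  rewrite addrAC -[leLHS]add0r lerD ?addr_ge0 ?expR_ge0// ler_expR.
  suff : 0 <= h * y i * (Z i w - sigma) by lra.
  by rewrite mulr_ge0// subr_ge0 ltW.
have key : (expR (y i * psi th i) <= c1 * fine (P E)
    + c2 * expR (y i * psi (th + h) i) + c3 * expR (y i * psi (th - h) i)).
  rewrite -lee_fin -mgf1 !EFinD !EFinM -mgf2 -mgf3 fineK ?fin_num_measure//.
  rewrite -[X in P X]setIT -integral_indic// -!ge0_integralZl_EFin ?expR_ge0//; try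
    by [apply/measurable_EFinP; exact: measurable_exp |
        apply/measurable_EFinP; exact: measurable_indic].
  have m1 : measurable_fun setT (fun w => (c1%:E * (\1_E w)%:E)%E).
    by apply/measurable_EFinP; apply: measurable_funM => //; exact: measurable_indic.
  have m2 th' c : measurable_fun setT (fun w => (c%:E * (expR (th' * y i * Z i w))%:E)%E).
    by apply/measurable_EFinP; apply: measurable_funM => //; exact: measurable_exp.
  have p1 w : (0 <= c1%:E * (\1_E w)%:E)%E by rewrite -EFinM lee_fin mulr_ge0 ?expR_ge0// indicE.
  have p2 c w x : (0 <= (expR c)%:E * (expR (x * Z i w))%:E)%E by rewrite -EFinM lee_fin mulr_ge0 ?expR_ge0.
  rewrite -ge0_integralD//; [|by move=> w _; exact: p2].
  rewrite -ge0_integralD//; last first.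
  - by move=> w _; exact: p2.
  - exact: emeasurable_funD.
  - by move=> w _; rewrite adde_ge0//; exact: p2.
  apply: ge0_le_integral => //.
  - by apply/measurable_EFinP; exact: measurable_exp.
  - by apply: emeasurable_funD => //; exact: emeasurable_funD.
  - by move=> w _; rewrite -!EFinM -!EFinD lee_fin; exact: split_exp.
set q := th ^+ 2 * sigma ^+ 2 / 2 in psi1.
(* [I2] and [I3]: in the limit the two outer terms of [key] have exponent [q - 4 e], against [q] for
   the left side. [I4] compares the inner term with the target rate 1/2, since
   [(1 - b / sigma)^2 / 2 = 4 e]. *)
have I2 : (th + h) ^+ 2 * sigma ^+ 2 / 2 - h * sigma = q - 4 * e.
  by rewrite /q /th /h /b /e; field.
have I3 : (th - h) ^+ 2 * sigma ^+ 2 / 2 + h * (sigma - 2 * delta) = q - 4 * e.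
  by rewrite /q /th /h /b /e; field.
have I4 : q - e - th * sigma + 1 / 2 = 3 * e.
  by rewrite /q /th /h /b /e; field.
have B1 : expR (y i * (q - e)) <= expR (y i * psi th i).
  rewrite ler_expR ler_wpM2l//.
  by move: psi1; rewrite ltr_distlC => /andP[? ?]; lra.
have B2 : c2 * expR (y i * psi (th + h) i) <= expR (y i * (q - 3 * e)).
  rewrite /c2 -expRD ler_expR.
  suff : 0 <= y i * (q - 3 * e + h * sigma - psi (th + h) i) by lra.
  by rewrite mulr_ge0//; move: psi2; rewrite ltr_distlC => /andP[? ?]; lra.
have B3 : c3 * expR (y i * psi (th - h) i) <= expR (y i * (q - 3 * e)).
  rewrite /c3 -expRD ler_expR.
  suff : 0 <= y i * (q - 3 * e - h * (sigma - 2 * delta) - psi (th - h) i) by lra.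
  by rewrite mulr_ge0//; move: psi3; rewrite ltr_distlC => /andP[? ?]; lra.
(* The threshold on [y] gives [2 e y >= 3], hence [exp (2 e y) >= 1 + 3]. *)
have B4 : 4 * expR (y i * (q - 3 * e)) <= expR (y i * (q - e)).
  have -> : y i * (q - e) = 2 * e * y i + y i * (q - 3 * e) by ring.
  rewrite expRD ler_wpM2r ?expR_ge0//; apply: le_trans (expR_ge1Dx _).
  by move: y0; rewrite ler_pdivrMr//; lra.
have B5 : expR (- (y i / 2)) * c1 <= expR (y i * (q - e)).
  rewrite /c1 -expRD ler_expR.
  suff : 0 <= y i * (q - e - th * sigma + 1 / 2) by lra.
  by rewrite I4 mulr_ge0//; lra.
(* By [B2], [B3] and [B4] the outer terms take at most half of [exp (y (q - e))]; the other half is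
   left for [c1] times the probability, and [B5] converts it into [exp (- y / 2) / 2]. *)
have c10 : 0 < c1 by exact: expR_gt0.
rewrite -[leRHS]fineK ?fin_num_measure// lee_fin -(ler_pM2l c10).
lra.
Unshelve. all: by end_near. Qed.

End large_deviations.

(** * Borel-Cantelli lemmas *)

Section borel_cantelli.
Context {R : realType} {dt : measure_display} {T : measurableType dt}.
Variable (P : probability T R).

(** A telescoping majorant for the series of [x^-(1 + k)], obtained from [ln (1 - 1/x) <= - 1/x] and
    [exp s >= 1 + s]. *)
Lemma powR_telescope (x k : R) : 1 < x -> 0 < k ->
  k * x `^ (- (1 + k)) <= (x - 1) `^ (- k) - x `^ (- k).
Proof.
move=> x1 k0; have x0 : 0 < x by lra.
have -> : x `^ (- (1 + k)) = x^-1 * x `^ (- k).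
  by rewrite opprD powRD ?powR_inv1 ?ltW// (gt_eqF x0) implybT.
rewrite lerBrDr -[X in _ + X]mul1r mulrA -mulrDl.
rewrite {2}/powR gt_eqF ?subr_gt0// /powR gt_eqF//.
rewrite -ler_pdivlMr ?expR_gt0// -expRN -expRD.
apply: le_trans (expR_ge1Dx _); rewrite addrC lerD2l.
have h : ln (x - 1) <= ln x - x^-1.
  have -> : x - 1 = x * (1 - x^-1) by rewrite mulrBr mulr1 divff// gt_eqF.
  rewrite lnM ?posrE ?subr_gt0 ?invf_lt1// lerD2l.
  by apply: le_ln1Dx; rewrite ltrN2 invf_lt1.
have : k * x^-1 <= k * (ln x - ln (x - 1)) by apply: ler_wpM2l; [exact: ltW|lra].
lra.
Qed.

(** First Borel-Cantelli lemma, with the sum of the probabilities bounded by telescoping. *)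
Lemma ae_eventually_not (F : nat -> set T) (C k : R) :
  (forall i, measurable (F i)) -> 1 < k ->
  (\forall i \near \oo, (P (F i) <= (C * i%:R `^ (- k))%:E)%E) ->
  {ae P, forall w, \forall i \near \oo, ~ F i w}.
Proof.
move=> mF k1 [N0 _ HN]; pose N := maxn N0 1.
(* The shift starts where the bound on [P (F i)] holds, and [N >= 1] keeps the base above 1 as the
   telescoping bound requires. *)
pose G n := F (n + N.+1)%N.
have G0 : P (lim_sup_set G) = 0%E.
  apply: lim_sup_set_cvg0; first by move=> n; exact: mF.
  have [B HB] : exists B : R, forall n, (\sum_(0 <= i < n) P (G i) <= B%:E)%E.
    (* The telescoped sum is at most [N^-(k - 1) <= 1]; the absolute value covers a negative [C]. *)
    exists (`|C| / (k - 1)) => n.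
    have k10 : 0 < k - 1 by lra.
    apply: (@le_trans _ _ (\sum_(0 <= i < n) (`|C| / (k - 1) *
        ((i + N)%:R `^ (- (k - 1)) - (i.+1 + N)%:R `^ (- (k - 1))))%:E)%E).
      apply: lee_sum => i _.
      have /HN : (N0 <= i + N.+1)%N by rewrite (leq_trans (leq_maxl N0 1))// -/N addnS leqW// leq_addl.
      move=> /le_trans; apply; rewrite lee_fin.
      apply: (@le_trans _ _ (`|C| * (i + N.+1)%:R `^ (- k))).
        by apply: ler_wpM2r; [exact: powR_ge0|exact: ler_norm].
      rewrite -mulrA ler_wpM2l// mulrC ler_pdivlMr// mulrC.
      have x1 : 1 < (i + N.+1)%:R :> R.
        by rewrite ltr1n addnS ltnS addn_gt0 /N leq_max ltnSn !orbT.
      have := powR_telescope _ _ x1 k10.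
      rewrite (_ : 1 + (k - 1) = k); last by ring.
      by rewrite addSnnS {2}addnS -natr1 addrK.
    rewrite sumEFin lee_fin -mulr_sumr; apply: ler_piMr; first by rewrite divr_ge0// ltW.
    under eq_bigr do rewrite -opprB.
    rewrite sumrN (telescope_sumr (fun i => (i + N)%:R `^ (- (k - 1))))// opprB add0n.
    apply: (@le_trans _ _ (N%:R `^ (- (k - 1)))); first by rewrite gerBl powR_ge0.
    rewrite powRN invf_le1 ?powR_gt0 ?ltr0n /N ?leq_max ?orbT//.
    rewrite -[leLHS](_ : (1 : R) `^ (k - 1) = 1); last by rewrite powR1.
    by apply: ge0_ler_powR; rewrite ?nnegrE ?ler1n ?leq_max ?orbT// ltW.
  apply: (le_lt_trans _ (ltry B)); apply: lime_le.
    by apply: is_cvg_nneseries => n _ _.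
  by apply: nearW => n; exact: HB.
exists (lim_sup_set G); split => //.
  apply: bigcapT_measurable => n; apply: bigcup_measurable => j _; exact: mF.
move=> w /= nw n _; apply: contrapT => hn; apply: nw.
exists (n + N.+1)%N => // i /= ni Fi; apply: hn.
have Ni : (N.+1 <= i)%N by rewrite (leq_trans _ ni)// leq_addl.
exists (i - N.+1)%N; last by rewrite /G subnK.
by rewrite /= -(leq_add2r N.+1) subnK.
Qed.

(** Second Borel-Cantelli lemma. By [1 - x <= exp (- x)], the probability that no event occurs from
    [m] to [n] is at most [exp (- c sum 1/i)]; if its limit were positive, the harmonic series would
    converge. *)
Lemma ae_infinitely_often (F : nat -> set T) (c : R) (m0 : nat) :
  (forall i, measurable (F i)) -> 0 < c ->
  (\forall i \near \oo, ((c / i%:R)%:E <= P (F i))%E) ->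
  (forall m n, (m0 <= m)%N -> P (\big[setI/setT]_(i <- index_iota m n) ~` F i) =
    (\prod_(i <- index_iota m n) P (~` F i))%E) ->
  {ae P, forall w, forall m, exists2 i, (m <= i)%N & F i w}.
Proof.
move=> mF c0 [N0 _ HN] indF; pose N := maxn m0 (maxn N0 1).
have tail0 m : (N <= m)%N -> P (\bigcap_(i >= m) ~` F i) = 0%E.
  move=> Nm; set A := \bigcap_(_ >= _) _.
  have mA : measurable A by apply: bigcap_measurable => [|i _]; [exists m => /=|exact: measurableC].
  apply/eqP/negPn/negP => PA0.
  have PAfin : P A \is a fin_num by exact: fin_num_measure.
  have a0 : 0 < fine (P A) by rewrite fine_gt0// lt0e PA0 measure_ge0 ltey_eq PAfin.
  have bound n : fine (P A) <= expR (- (c * \sum_(m <= i < n) i%:R^-1)).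
    rewrite -lee_fin fineK//.
    apply: (@le_trans _ _ (P (\big[setI/setT]_(i <- index_iota m n) ~` F i))).
      apply: le_measure; rewrite ?inE//.
        by apply: bigsetI_measurable => i _; exact: measurableC.
      rewrite -bigcap_seq => w Aw i /=; rewrite mem_index_iota => /andP[mi _].
      exact: Aw.
    rewrite indF; last by rewrite (leq_trans _ Nm)// leq_maxl.
    have PC i : (P (~` F i) = (1 - fine (P (F i)))%:E)%E.
      by rewrite probability_setC// EFinB fineK ?fin_num_measure.
    under eq_bigr do rewrite PC.
    rewrite prodEFin lee_fin mulr_sumr -sumrN expR_sum.
    rewrite big_seq [leRHS]big_seq.
    apply: ler_prod => i; rewrite mem_index_iota => /andP[mi _].
    apply/andP; split; first by rewrite -lee_fin -PC measure_ge0.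
    apply: le_trans (expR_ge1Dx _); rewrite lerD2l lerN2 -lee_fin fineK ?fin_num_measure//.
    apply: HN => /=; rewrite (leq_trans _ mi)// (leq_trans _ Nm)// /N.
    by rewrite !leq_max leqnn orbT.
  have {}bound n : \sum_(m <= i < n) i%:R^-1 <= - ln (fine (P A)) / c.
    rewrite ler_pdivlMr// lerNr mulrC -[leRHS]expRK ler_ln ?posrE ?expR_gt0//.
  apply: (@dvg_harmonic R).
  apply: nondecreasing_is_cvgn.
    by apply/nondecreasing_seqP => n; rewrite seriesSr lerDl harmonic_ge0.
  (* The first sum accounts for the indices below [m], the second term is [bound]. *)
  exists (\sum_(1 <= i < m) i%:R^-1 - ln (fine (P A)) / c) => _ [n _ <-].
  rewrite /series /= -(big_add1 _ _ 0 n.+1 xpredT (fun i => i%:R^-1)).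
  have [mn|nm] := leqP m n.+1.
    rewrite (@big_cat_nat _ _ _ m)//=; last first.
      by rewrite (leq_trans _ Nm)// /N !leq_max !orbT.
    by rewrite lerD2l -mulNr bound.
  rewrite (@big_cat_nat _ _ _ n.+1 1%N m)//=; last exact: ltnW.
  rewrite -addrA lerDl.
  rewrite addr_ge0//; first by apply: sumr_ge0.
  (* At [n = m] the sum in [bound] is empty, which says that [- ln (P A) / c] is nonnegative. *)
  by have := bound m; rewrite big_geq// -mulNr.
have neg : P.-negligible (\bigcup_m \bigcap_(i >= m + N) ~` F i).
  apply: negligible_bigcup => m; exists (\bigcap_(i >= m + N) ~` F i); split => //.
    by apply: bigcap_measurable => [|i _]; [exists (m + N)%N => /=|exact: measurableC].
  by apply: tail0; exact: leq_addl.
apply: negligibleS neg => w /= nw.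
have [m hm] : exists m, forall i, (m <= i)%N -> ~ F i w.
  apply: contrapT => hn; apply: nw => m; apply: contrapT => hm; apply: hn.
  by exists m => i mi Fi; apply: hm; exists i.
by exists m => // i /= mi; apply: hm; rewrite (leq_trans _ mi)// leq_addr.
Qed.

End borel_cantelli.

(** * Sums over disjoint blocks *)

Section log_mgf_limit.
Context {R : realType}.
Implicit Types N y u mu v L mgf : nat -> R.

(** Expand [mgf = 1 + r] to second order: the mean term vanishes, the variance term gives
    [th^2 s2 / 2], and the cubic error is of relative size [|u| L]. As [y / N] tends to 0, so does
    [r], and [ln (1 + r)] can be replaced by [r]. *)
Lemma log_mgf_cvg N y u mu v L mgf (th s2 : R) :
  (\forall i \near \oo, 0 < N i) -> (\forall i \near \oo, 0 < y i) ->
  (\forall i \near \oo, N i * u i ^+ 2 / y i = th ^+ 2) ->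
  (\forall i \near \oo, 0 < L i) -> (forall i, 0 <= v i) ->
  (fun i => N i * u i * mu i / y i) @ \oo --> (0 : R) ->
  v @ \oo --> s2 -> (fun i => `|u i| * L i) @ \oo --> (0 : R) ->
  (fun i => y i / N i) @ \oo --> (0 : R) ->
  (forall i, 0 < L i -> `|u i| * L i <= 1 ->
    `|mgf i - (1 + u i * mu i + u i ^+ 2 / 2 * v i)| <= `|u i| ^+ 3 * L i * v i) ->
  (fun i => N i * ln (mgf i) / y i) @ \oo --> th ^+ 2 * s2 / 2.
Proof.
move=> N0 y0 Nu L0 v0 cmu cv cuL cyN taylor.
have uL1 : \forall i \near \oo, `|u i| * L i <= 1.
  have /cvgrPdist_lt /(_ _ ltr01) H := cuL.
  near=> i; have : `|0 - `|u i| * L i| < 1 by near: i.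
  by rewrite sub0r normrN => /ltW; apply: le_trans; exact: ler_norm.
pose r i := mgf i - 1.
pose q i := N i * r i / y i.
pose main i := N i * u i * mu i / y i + th ^+ 2 / 2 * v i.
have cmain : main @ \oo --> th ^+ 2 * s2 / 2.
  rewrite (_ : th ^+ 2 * s2 / 2 = 0 + th ^+ 2 / 2 * s2); last by ring.
  by apply: cvgD => //; apply: cvgM => //; exact: cvg_cst.
have cdiff : (fun i => q i - main i) @ \oo --> (0 : R).
  apply: norm_cvg0; apply: (@squeeze_cvgr _ _ _ _ (cst 0) (fun i => th ^+ 2 * (`|u i| * L i) * v i)).
  - near=> i; rewrite normr_ge0 /=.
    have Ni : 0 < N i by near: i.
    have yi : 0 < y i by near: i.
    have Li : 0 < L i by near: i.
    have Nui : N i * u i ^+ 2 / y i = th ^+ 2 by near: i.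
    have uLi : `|u i| * L i <= 1 by near: i.
    have -> : q i - main i =
        N i / y i * (mgf i - (1 + u i * mu i + u i ^+ 2 / 2 * v i)).
      rewrite /main -Nui /q /r; field; lra.
    have NY : 0 <= N i / y i by apply: divr_ge0; exact: ltW.
    rewrite normrM (ger0_norm NY).
    rewrite -Nui [leRHS](_ : _ = N i / y i * (`|u i| ^+ 3 * L i * v i)); last first.
      by rewrite -(real_normK (num_real (u i))); field; lra.
    by apply: ler_wpM2l => //; exact: taylor.
  - exact: cvg_cst.
  - rewrite -(mul0r s2) -{1}(mulr0 (th ^+ 2)).
    by apply: cvgM => //; apply: cvgM => //; exact: cvg_cst.
have cq : q @ \oo --> th ^+ 2 * s2 / 2.
  rewrite (_ : q = (fun i => (q i - main i) + main i)); last first.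
    by apply/funext => i; rewrite subrK.
  by rewrite -[X in _ --> X]add0r; apply: cvgD.
(* [q] has a finite limit and [r] is eventually [q] times [y / N]. *)
have cr : r @ \oo --> (0 : R).
  apply: (@cvg_trans _ ((fun i => q i * (y i / N i)) @ \oo)).
    apply: near_eq_cvg; near=> i.
    have Ni : 0 < N i by near: i.
    have yi : 0 < y i by near: i.
    by rewrite /q /r; field; lra.
  by rewrite -(mulr0 (th ^+ 2 * s2 / 2)); exact: cvgM.
have half0 : 0 < 1 / 2 :> R by lra.
have /cvgrPdist_lt /(_ _ half0) near_r := cr.
(* From [r - 2 r^2 <= ln (1 + r) <= r], valid once [r >= - 1/2]. *)
apply: (@squeeze_cvgr _ _ _ _ (fun i => q i - 2 * (q i * r i)) q) => //.
- near=> i.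
  have Ni : 0 < N i by near: i.
  have yi : 0 < y i by near: i.
  have ri : - (1 / 2) <= r i.
    have : `|0 - r i| < 1 / 2 by near: i.
    by rewrite sub0r normrN ltr_norml => /andP[/ltW].
  have -> : mgf i = 1 + r i by rewrite /r addrC subrK.
  have -> : q i - 2 * (q i * r i) = N i * (r i - 2 * r i ^+ 2) / y i.
    by rewrite /q; field; lra.
  have iy : 0 <= (y i)^-1 by rewrite invr_ge0 ltW.
  apply/andP; split; apply: ler_wpM2r => //; apply: ler_wpM2l; [exact: ltW| |exact: ltW|].
    exact: ln1D_ge.
  by apply: le_ln1Dx; lra.
- rewrite -[X in _ --> X]subr0; apply: cvgB => //.
  rewrite -(mulr0 2); apply: cvgM; first exact: cvg_cst.
  by rewrite -(mulr0 (th ^+ 2 * s2 / 2)); exact: cvgM.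
Unshelve. all: by end_near. Qed.

Lemma cvg_powRN0 (e : R) : 0 < e -> (fun i : nat => i%:R `^ (- e)) @ \oo --> (0 : R).
Proof.
move=> e0; apply/cvgrPdist_le => eps eps0.
have := @cvgr_idn R => /cvgryPge /(_ (Num.max 1 (eps^-1 `^ e^-1))) H.
near=> i; have : Num.max 1 (eps^-1 `^ e^-1) <= i%:R by near: i.
rewrite ge_max => /andP[i1 hi].
rewrite sub0r normrN ger0_norm ?powR_ge0// powRN.
rewrite -[leRHS]invrK lef_pV2 ?posrE ?powR_gt0 ?invr_gt0//; last lra.
have -> : eps^-1 = (eps^-1 `^ e^-1) `^ e.
  by rewrite -powRrM mulVf ?gt_eqF// powRr1// invr_ge0 ltW.
by apply: ge0_ler_powR; rewrite ?nnegrE ?powR_ge0// ?ltW//; lra.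
Unshelve. all: by end_near. Qed.

Lemma ln_le_powR (x e : R) : 1 <= x -> 0 < e -> ln x <= x `^ e / e.
Proof.
move=> x1 e0; rewrite ler_pdivlMr// mulrC -ln_powR.
apply: (le_trans (ltW (ln_sublinear _))) => //.
by rewrite powR_gt0//; lra.
Qed.

Lemma cvg_ln_powRN0 (e : R) : 0 < e -> (fun i : nat => ln i%:R * i%:R `^ (- e)) @ \oo --> (0 : R).
Proof.
move=> e0.
apply: (@squeeze_cvgr _ _ _ _ (cst 0) (fun i : nat => i%:R `^ (- (e / 2)) / (e / 2))).
- near=> i; have i1 : 1 <= i%:R :> R by rewrite ler1n; near: i; exists 1%N.
  rewrite mulr_ge0 ?powR_ge0 ?ln_ge0//=.
  have e20 : 0 < e / 2 by lra.
  have -> : i%:R `^ (- (e / 2)) = i%:R `^ (e / 2) * i%:R `^ (- e) :> R.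
    rewrite -powRD; first by congr (_ `^ _); lra.
    by rewrite (gt_eqF (lt_le_trans ltr01 i1)) implybT.
  by rewrite mulrAC ler_wpM2r ?powR_ge0//; exact: ln_le_powR.
- exact: cvg_cst.
- rewrite -(mul0r (e / 2)^-1); apply: cvgM; last exact: cvg_cst.
  by apply: cvg_powRN0; lra.
Unshelve. all: by end_near. Qed.

Lemma cvg_ln_nat : (fun i : nat => ln i%:R : R) @ \oo --> +oo.
Proof.
apply/cvgryPge => A.
have := @cvgr_idn R => /cvgryPge /(_ (expR A)) H.
near=> i; have h : expR A <= i%:R by near: i.
by rewrite -[leLHS]expRK ler_ln ?posrE ?expR_gt0//; apply: lt_le_trans h; exact: expR_gt0.
Unshelve. all: by end_near. Qed.

End log_mgf_limit.

(** Places events about a block sum in the sigma-algebra of that block, as [blocks_independent]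
    demands. *)
Lemma sigma_cylinders_sum_le {R : realType} {dt : measure_display} {T : measurableType dt}
    (P : probability T R) (I : eqType) (X : I -> {RV P >-> R}) (J : seq I) (f : R -> R) (c : R) :
  measurable_fun setT f ->
  <<s cylinders P X J >>
    [set w | \sum_(k <- J) f (X k w) <= c].
Proof.
move=> mf; set G := cylinders P X J.
have mk (k : I) : k \in J -> @measurable_fun _ _ (g_sigma_algebraType G) R setT (fun w => f (X k w)).
  move=> kJ _ B mB; rewrite setTI; apply: sub_sigma_algebra.
  (* The preimage is a cylinder with the whole line in every other coordinate. *)
  exists (fun j => if j == k then f @^-1` B else setT).
    move=> j; case: ifP => // _; rewrite -[X in measurable X]setTI; exact: mf.
  apply/seteqP; split => [w wB j /= jJ|w /(_ k kJ)]; last by rewrite eqxx.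
  by case: ifP => // /eqP ->.
have mS : @measurable_fun _ _ (g_sigma_algebraType G) R setT (fun w => \sum_(k <- J) f (X k w)).
  under eq_fun do rewrite big_seq big_mkcond.
  apply: (@measurable_sum _ (g_sigma_algebraType G)) => k.
  by case: (boolP (k \in J)) => [kJ|_]; [exact: mk|exact: measurable_cst].
have := mS measurableT `]-oo, c]%classic (measurable_itv _).
by rewrite setTI.
Qed.

(** * Logarithmic law for the sums over disjoint blocks of polynomial size *)

Section block_lil.
Context {R : realType} {dt : measure_display} {T : measurableType dt}.
Variable (P : probability T R).
Context {I : eqType} (X : I -> {RV P >-> R}) (D : pred I) (X0 : {RV P >-> R}).
Hypothesis indX : rect_independent P X D.
Hypothesis idX : forall k, D k -> forall B : set R, measurable B ->
  P (X k @^-1` B) = P (X0 @^-1` B).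

Lemma ge0_integral_ident (k : I) (f : R -> R) : D k ->
  measurable_fun setT f -> (forall x, 0 <= f x) ->
  (\int[P]_w (f (X k w))%:E = \int[P]_w (f (X0 w))%:E)%E.
Proof.
move=> Dk mf f0.
have mfE : measurable_fun setT (fun x : R => (f x)%:E) by exact/measurable_EFinP.
rewrite -(ge0_integral_distribution (X k) mfE) -?(ge0_integral_distribution X0 mfE)//.
by apply: eq_measure_integral => B mB _; exact: idX.
Qed.

Variables (sigma p : R).
Hypothesis p2 : 2 < p.
Hypothesis iX : P.-integrable setT (EFin \o X0).
Hypothesis iX2 : P.-integrable setT (EFin \o (fun w => X0 w ^+ 2)).
Hypothesis iXp : P.-integrable setT (EFin \o (fun w => `|X0 w| `^ p)).
Hypothesis EX0 : \int[P]_w X0 w = 0.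
Hypothesis EX2 : \int[P]_w (X0 w ^+ 2) = sigma ^+ 2.

Variables (J : nat -> seq I) (m0 : nat) (g c0 : R).
Hypothesis DJ : forall i, all D (J i).
Hypothesis uJ : forall i, uniq (J i).
Hypothesis disjJ : forall m n, (m0 <= m)%N -> uniq (flatten (map J (index_iota m n))).
Hypothesis g0 : 0 < g.
Hypothesis c00 : 0 < c0.
Hypothesis size_le : \forall i \near \oo, (size (J i))%:R <= i%:R `^ g.
Hypothesis size_ge : \forall i \near \oo, c0 * i%:R `^ g <= (size (J i))%:R.
Hypothesis pg : 1 + g < p * (g / 2).

Let M := \int[P]_w (`|X0 w| `^ p).
(** The midpoint of an interval that [pg] makes non-empty: its lower end makes the truncation errors
    summable, its upper end makes [u th i * L i] vanish. *)
Let h := ((1 + g) / p + g / 2) / 2.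
Let N i : R := (size (J i))%:R.
Let y (i : nat) : R := 2 * ln i%:R.
Let a i := Num.sqrt (N i * y i).
Let L (i : nat) : R := i%:R `^ h.
Let S' i w := \sum_(k <- J i) trunc (L i) (X k w).
Let Z i w := S' i w / a i.
(** The coefficient of the truncated sum [S'] in the exponent [th * y i * Z i w]. *)
Let u th i := th * y i / a i.
Let psi th i := N i * ln (mgf_trunc P X0 (L i) (u th i)) / y i.

Let p0 : 0 < p. Proof. exact: lt_trans p2. Qed.
Let ph : 1 + g < p * h.
Proof.
have : (1 + g) / p < g / 2 by rewrite ltr_pdivrMr// mulrC.
rewrite /h => lt1; have := p0 => p0'.
rewrite [ltLHS](_ : _ = p * ((1 + g) / p)); last by rewrite mulrCA divff ?mulr1// gt_eqF.
by rewrite ltr_pM2l// (midf_lt lt1).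
Qed.
Let hg : h < g / 2.
Proof.
have : (1 + g) / p < g / 2 by rewrite ltr_pdivrMr// mulrC.
by move=> lt1; rewrite /h (midf_lt lt1).
Qed.

Let near_i1 : \forall i \near \oo, 1 <= (i : nat)%:R :> R.
Proof. by exists 1%N => // i /=; rewrite ler1n. Qed.
Let near_y1 : \forall i \near \oo, 1 <= y i.
Proof.
have /cvgryPge /(_ 1) H := @cvg_ln_nat R.
near=> i; have : 1 <= ln i%:R :> R by near: i.
by rewrite /y; lra.
Unshelve. all: by end_near. Qed.
Let near_N0 : \forall i \near \oo, 0 < N i.
Proof.
near=> i; have i1 : 1 <= i%:R :> R by near: i.
apply: (@lt_le_trans _ _ (c0 * i%:R `^ g)); last by near: i.
by rewrite mulr_gt0// powR_gt0// (lt_le_trans ltr01 i1).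
Unshelve. all: by end_near. Qed.
Let near_L0 : \forall i \near \oo, 0 < L i.
Proof.
near=> i; have i1 : 1 <= i%:R :> R by near: i.
by rewrite powR_gt0// (lt_le_trans ltr01 i1).
Unshelve. all: by end_near. Qed.
Let L_ge0 i : 0 <= L i. Proof. exact: powR_ge0. Qed.

Let cvg_yN : (fun i => y i / N i) @ \oo --> (0 : R).
Proof.
apply: (@squeeze_cvgr _ _ _ _ (cst 0) (fun i : nat => 2 / c0 * (ln i%:R * i%:R `^ (- g)))).
- near=> i.
  have y1 : 1 <= y i by near: i.
  have Ni : 0 < N i by near: i.
  have i1 : 1 <= i%:R :> R by near: i.
  have i0 : 0 < i%:R `^ g :> R by rewrite powR_gt0// (lt_le_trans ltr01 i1).
  have Nc : c0 * i%:R `^ g <= N i by near: i.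
  apply/andP; split; first by apply: divr_ge0; lra.
  rewrite ler_pdivrMr// powRN /y.
  have l0 : 0 <= ln i%:R :> R by exact: ln_ge0.
  have -> : 2 / c0 * (ln i%:R / i%:R `^ g) * N i = 2 * ln i%:R * (N i / (c0 * i%:R `^ g)).
    by field; rewrite !gt_eqF.
  rewrite -[leLHS]mulr1; apply: ler_wpM2l; first by apply: mulr_ge0.
  by rewrite ler_pdivlMr ?mul1r// mulr_gt0.
- exact: cvg_cst.
- rewrite -(mulr0 (2 / c0)); apply: cvgM; first exact: cvg_cst.
  exact: cvg_ln_powRN0.
Unshelve. all: by end_near. Qed.

(** Up to constants this is [ln i * i^(2 h - g)], and [h < g / 2]. *)
Let cvg_yLN : (fun i => y i * L i ^+ 2 / N i) @ \oo --> (0 : R).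
Proof.
apply: (@squeeze_cvgr _ _ _ _ (cst 0) (fun i : nat => 2 / c0 * (ln i%:R * i%:R `^ (- (g - 2 * h))))).
- near=> i.
  have y1 : 1 <= y i by near: i.
  have Ni : 0 < N i by near: i.
  have i1 : 1 <= i%:R :> R by near: i.
  have ii0 : i%:R != 0 :> R by rewrite gt_eqF// (lt_le_trans ltr01 i1).
  have i0 : 0 < i%:R `^ g :> R by rewrite powR_gt0// (lt_le_trans ltr01 i1).
  have Nc : c0 * i%:R `^ g <= N i by near: i.
  have l0 : 0 <= ln i%:R :> R by exact: ln_ge0.
  apply/andP; split.
    by apply: divr_ge0; [apply: mulr_ge0; [lra|exact: sqr_ge0]|exact: ltW].
  have -> : i%:R `^ (- (g - 2 * h)) = L i ^+ 2 / i%:R `^ g :> R.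
    rewrite opprB powRD ?ii0 ?implybT// powRN; congr (_ / _).
    by rewrite /L -powR_mulrn ?powR_ge0// -powRrM mulrC.
  rewrite ler_pdivrMr// /y.
  have -> : 2 / c0 * (ln i%:R * (L i ^+ 2 / i%:R `^ g)) * N i
     = 2 * ln i%:R * L i ^+ 2 * (N i / (c0 * i%:R `^ g)).
    by field; rewrite !gt_eqF.
  rewrite -[leLHS]mulr1; apply: ler_wpM2l; first by rewrite !mulr_ge0 ?sqr_ge0.
  by rewrite ler_pdivlMr ?mul1r// mulr_gt0.
- exact: cvg_cst.
- rewrite -(mulr0 (2 / c0)); apply: cvgM; first exact: cvg_cst.
  apply: cvg_ln_powRN0; have := hg; lra.
Unshelve. all: by end_near. Qed.

(** Since [a = sqrt (N y)], the product is [|th|] times the square root of the quantity in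
    [cvg_yLN]. *)
Let cvg_uL th : (fun i => `|u th i| * L i) @ \oo --> (0 : R).
Proof.
have E : \forall i \near \oo, `|th| * Num.sqrt (y i * L i ^+ 2 / N i) = `|u th i| * L i.
  near=> i.
  have y1 : 1 <= y i by near: i.
  have Ni : 0 < N i by near: i.
  have y0 : 0 <= y i by lra.
  have a0 : 0 < a i by rewrite sqrtr_gt0 mulr_gt0//; lra.
  have yN0 : 0 <= y i * L i ^+ 2 / N i.
    by apply: divr_ge0; [apply: mulr_ge0 => //; exact: sqr_ge0|exact: ltW].
  rewrite /u 2!normrM normfV (ger0_norm y0) (gtr0_norm a0).
  rewrite [RHS](_ : _ = `|th| * (y i / a i * L i)); last by rewrite !mulrA.
  congr (_ * _).
  have -> : y i * L i ^+ 2 / N i = (y i / a i * L i) ^+ 2.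
    rewrite 2!exprMn exprVn /a sqr_sqrtr; last by rewrite mulr_ge0// ltW.
    by field; apply/andP; split; lra.
  rewrite sqrtr_sqr ger0_norm//; apply: mulr_ge0 => //; apply: divr_ge0 => //; exact: ltW.
apply: cvg_trans (near_eq_cvg E) _.
rewrite -(mulr0 `|th|); apply: cvgM; first exact: cvg_cst.
rewrite -[X in _ --> X](sqrtr0 R).
exact: (cvg_comp _ _ cvg_yLN (@sqrt_continuous R 0)).
Unshelve. all: by end_near. Qed.

Let Lpow_cvg0 e : 0 < e -> (fun i => L i `^ (- e)) @ \oo --> (0 : R).
Proof.
move=> e0; have h0 : 0 < h.
  have g20 : 0 < g / 2 by rewrite divr_gt0.
  have gp0 : 0 < (1 + g) / p by rewrite divr_gt0 ?addr_gt0.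
  by rewrite /h divr_gt0// addr_gt0.
under eq_fun do rewrite /L -powRrM mulrN.
by apply: cvg_powRN0; rewrite mulr_gt0.
Qed.

Let mu i := \int[P]_w trunc (L i) (X0 w).
Let v i := \int[P]_w (trunc (L i) (X0 w) ^+ 2).

Let cvg_v : v @ \oo --> sigma ^+ 2.
Proof.
apply: (@squeeze_cvgr _ _ _ _ (fun i => sigma ^+ 2 - M * L i `^ (- (p - 2))) (cst (sigma ^+ 2))).
- near=> i; have Li : 0 < L i by near: i.
  have := second_moment_trunc P X0 sigma p p2 iX2 iXp EX2 _ Li.
  by rewrite opprB.
- rewrite -[X in _ --> X]subr0 -(mulr0 M); apply: cvgB; first exact: cvg_cst.
  apply: cvgM; first exact: cvg_cst.
  by apply: Lpow_cvg0; rewrite subr_gt0.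
- exact: cvg_cst.
Unshelve. all: by end_near. Qed.

(** The expression is [th (N / a) mu] with [N / a <= i^(g / 2)] and [|mu| <= M i^(h (1 - p))]. By
    [hg] and [ph] the total exponent [g / 2 + h - h p] is below -1. *)
Let cvg_mu th : (fun i => N i * u th i * mu i / y i) @ \oo --> (0 : R).
Proof.
apply: norm_cvg0.
apply: (@squeeze_cvgr _ _ _ _ (cst 0) (fun i : nat => `|th| * M * i%:R `^ (- 1))).
- near=> i; rewrite normr_ge0 /=.
  have y1 : 1 <= y i by near: i.
  have Ni : 0 < N i by near: i.
  have Li : 0 < L i by near: i.
  have i1 : 1 <= i%:R :> R by near: i.
  have ii0 : i%:R != 0 :> R by rewrite gt_eqF// (lt_le_trans ltr01 i1).
  have Ng : N i <= i%:R `^ g by near: i.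
  have y0 : 0 < y i by lra.
  have a0 : 0 < a i by rewrite sqrtr_gt0 mulr_gt0.
  have -> : N i * u th i * mu i / y i = th * (N i / a i) * mu i.
    by rewrite /u; field; rewrite !gt_eqF.
  have Na : N i / a i <= i%:R `^ (g / 2).
    rewrite ler_pdivrMr//.
    have NN : N i = Num.sqrt (N i) * Num.sqrt (N i) by rewrite -expr2 sqr_sqrtr// ltW.
    have sN : Num.sqrt (N i) <= i%:R `^ (g / 2).
      rewrite powRrM (powR12_sqrt (powR_ge0 _ _)); exact: ler_wsqrtr.
    have sa : Num.sqrt (N i) <= a i.
      by rewrite /a; apply: ler_wsqrtr; rewrite ler_peMr// ltW.
    by rewrite [leLHS]NN; apply: ler_pM => //; exact: sqrtr_ge0.
  have mu_le : `|mu i| <= M * L i `^ (1 - p) by exact: mean_trunc_le.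
  have Na0 : 0 <= N i / a i by apply: divr_ge0; exact: ltW.
  rewrite 2!normrM (ger0_norm Na0) -[leLHS]mulrA -[leRHS]mulrA; apply: ler_wpM2l => //.
  apply: (le_trans (ler_pM Na0 (normr_ge0 _) Na mu_le)).
  rewrite mulrCA; apply: ler_wpM2l; first exact: moment_ge0.
  rewrite /L -powRrM -powRD ?ii0 ?implybT//.
  by apply: ler_powR => //; have := hg; have := ph; rewrite mulrBr mulr1 mulrC; lra.
- exact: cvg_cst.
- rewrite -(mulr0 (`|th| * M)); apply: cvgM; first exact: cvg_cst.
  exact: cvg_powRN0.
Unshelve. all: by end_near. Qed.

(** Positivity is what allows the exponential to undo the logarithm in [psi]. *)
Let mgf_gt0 (l w : R) : 0 <= l -> 0 < mgf_trunc P X0 l w.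
Proof.
move=> l0; apply: (@lt_le_trans _ _ (\int[P]_x expR (- (`|w| * l)))).
  rewrite Rintegral_cst// mulr_gt0 ?expR_gt0//.
  by rewrite (_ : fine _ = fine 1%E) ?ltr01// -(probability_setT P).
apply: le_Rintegral => //.
- exact: finite_measure_integrable_cst.
- exact: integrable_expR_trunc.
move=> x _; rewrite ler_expR lerNl -normrN; apply: (le_trans (ler_norm _)).
by rewrite normrN normrN normrM ler_wpM2l// norm_trunc_leL.
Qed.

Let psi_cvg th : psi th @ \oo --> th ^+ 2 * sigma ^+ 2 / 2.
Proof.
apply: (@log_mgf_cvg _ N y (u th) mu v L) => //.
- by near=> i; apply: (@lt_le_trans _ _ 1) => //; near: i.
- near=> i.
  have y1 : 1 <= y i by near: i.
  have Ni : 0 < N i by near: i.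
  have y0 : 0 < y i by lra.
  rewrite /u 2!exprMn exprVn /a sqr_sqrtr; last by rewrite mulr_ge0// ltW.
  by field; rewrite !gt_eqF.
- by move=> i; apply: Rintegral_ge0 => w _; exact: sqr_ge0.
- by move=> i Li uL; exact: mgf_trunc_taylor.
Unshelve. all: by end_near. Qed.

Let measurable_Z i : measurable_fun setT (Z i).
Proof.
apply: measurable_funM => //; apply: measurable_sum => k.
by apply: measurableT_comp => //; exact: measurable_trunc.
Qed.

(** By independence the exponential of the block sum integrates to a product, whose factors all
    equal the one for [X0]. *)
Let mgfZ th : \forall i \near \oo,
  (\int[P]_w (expR (th * y i * Z i w))%:E = (expR (y i * psi th i))%:E)%E.
Proof.
near=> i; have y1 : 1 <= y i by near: i.
have -> : expR (y i * psi th i) = mgf_trunc P X0 (L i) (u th i) ^+ size (J i).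
  rewrite -{1}(@lnK _ (mgf_trunc P X0 (L i) (u th i))) ?posrE ?mgf_gt0//.
  rewrite -expRM_natl; congr expR.
  by rewrite /psi /N mulrCA divff ?mulr1// gt_eqF// (lt_le_trans ltr01 y1).
have E w : expR (th * y i * Z i w) =
    \prod_(k <- J i) expR (u th i * trunc (L i) (X k w)).
  rewrite -expR_sum -mulr_sumr; congr expR.
  by rewrite /Z /u mulrCA mulrC mulrA.
under eq_integral do rewrite E.
pose f (_ : I) (x : R) := expR (u th i * trunc (L i) x).
rewrite (@integral_prod_indep _ _ _ P _ X D indX f (J i))//; last 3 first.
- by move=> k; exact: measurable_expR_trunc.
- by move=> k x; exact: expR_ge0.
- move=> k; have := integrable_expR_trunc P (X k) (L i) (u th i) (L_ge0 i).
  move=> /integrableP[_]; under eq_integral do rewrite /= ger0_norm ?expR_ge0//.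
  by [].
have fE k : k \in J i -> (\int[P]_w (f k (X k w))%:E = (mgf_trunc P X0 (L i) (u th i))%:E)%E.
  move=> kJ; rewrite (ge0_integral_ident k (f k) (allP (DJ i) _ kJ)); last 2 first.
  - exact: measurable_expR_trunc.
  - by move=> x; exact: expR_ge0.
  rewrite /mgf_trunc /Rintegral fineK//; apply: integrable_fin_num => //.
  exact: integrable_expR_trunc.
rewrite (eq_big_seq (fun=> (mgf_trunc P X0 (L i) (u th i))%:E)); last by move=> k kJ; exact: fE.
by rewrite prodEFin big_const_seq count_predT iter_mulr_1.
Unshelve. all: by end_near. Qed.

Let cvg_y : y @ \oo --> +oo.
Proof.
apply/cvgryPge => A; have /cvgryPge /(_ (A / 2)) H := @cvg_ln_nat R.
near=> i; have : A / 2 <= ln i%:R :> R by near: i.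
by rewrite /y; lra.
Unshelve. all: by end_near. Qed.

(** With [y = 2 ln i], the rate 1/2 corresponds to the borderline [1 / i] of the two Borel-Cantelli
    lemmas. *)
Let expR_y (c : R) (i : nat) : 1 <= i%:R :> R -> expR (- (c * y i)) = i%:R `^ (- (2 * c)).
Proof.
move=> i1; rewrite /powR gt_eqF ?(lt_le_trans ltr01 i1)//; congr expR.
by rewrite /y; ring.
Qed.

Let near_a0 : \forall i \near \oo, 0 < a i.
Proof.
near=> i.
have y1 : 1 <= y i by near: i.
have Ni : 0 < N i by near: i.
by rewrite sqrtr_gt0 mulr_gt0// (lt_le_trans ltr01 y1).
Unshelve. all: by end_near. Qed.

(** A union bound over the block gives probability at most [M i^(g - p h)] that truncation alters a
    term, and [p h - g > 1]. *)
Let ae_trunc : {ae P, forall w, \forall i \near \oo, \sum_(k <- J i) X k w = S' i w}.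
Proof.
pose A i (k : I) := X k @^-1` [set x | L i < `|x|].
pose F i := \big[setU/set0]_(k <- J i) A i k.
have mset i : measurable [set x : R | L i < `|x|].
  rewrite (_ : mkset _ = (fun x => `|x|) @^-1` `]L i, +oo[); last first.
    by apply/seteqP; split => x /=; rewrite in_itv /= andbT.
  by rewrite -[X in measurable X]setTI; exact: normr_measurable.
have mA i k : measurable (A i k) by exact: measurable_RV_preimage.
have mF i : measurable (F i) by apply: bigsetU_measurable => k _; exact: mA.
have PF i : (P (F i) <= \sum_(k <- J i) P (A i k))%E.
  rewrite /F; elim: (J i) => [|k s IH]; first by rewrite !big_nil measure0.
  rewrite !big_cons; apply: (le_trans (measureU2 _ _ _)) => //.
    by apply: bigsetU_measurable => j _; exact: mA.
  by rewrite leeD2l.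
have ph1 : 1 < p * h - g by have := ph; lra.
have H : {ae P, forall w, \forall i \near \oo, ~ F i w}.
  apply: (@ae_eventually_not _ _ _ P F M _ mF ph1).
  near=> i.
  have i1 : 1 <= i%:R :> R by near: i.
  have ii0 : i%:R != 0 :> R by rewrite gt_eqF// (lt_le_trans ltr01 i1).
  have Li : 0 < L i by near: i.
  have Ng : N i <= i%:R `^ g by near: i.
  apply: (le_trans (PF i)).
  have PA k : k \in J i -> (P (A i k) <= (M * L i `^ (- p))%:E)%E.
    move=> kJ; rewrite /A idX//; last exact: (allP (DJ i)).
    exact: tail_trunc.
  apply: (@le_trans _ _ (\sum_(k <- J i) (M * L i `^ (- p))%:E)%E).
    by rewrite big_seq [leRHS]big_seq; apply: lee_sum => k; exact: PA.
  rewrite sumEFin lee_fin big_const_seq count_predT iter_addr_0 -[leLHS]mulr_natr -/(N i).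
  rewrite -mulrA; apply: ler_wpM2l; first exact: moment_ge0.
  rewrite opprB powRD ?ii0 ?implybT// mulrC; apply: ler_pM => //.
    exact: powR_ge0.
  by rewrite /L -powRrM mulrN mulrC.
apply: filterS H => w; apply: filterS => i nF.
apply: eq_big_seq => k kJ; rewrite /trunc; case: ifPn => //; rewrite -ltNge => LX.
by exfalso; apply: nF; rewrite /F (big_rem k kJ); left.
Unshelve. all: by end_near. Qed.

Lemma block_limsup_le (t : R) : 0 <= sigma -> sigma < t ->
  {ae P, forall w, \forall i \near \oo, \sum_(k <- J i) X k w < t * a i}.
Proof.
move=> s0 st.
have [c c12 H] := ldp_upper P Z y psi sigma measurable_Z cvg_y mgfZ psi_cvg t s0 st.
have mF i : measurable [set w | t <= Z i w].
  rewrite (_ : mkset _ = Z i @^-1` `[t, +oo[); last first.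
    by apply/seteqP; split => w /=; rewrite in_itv /= andbT.
  by rewrite -[X in measurable X]setTI; exact: measurable_Z.
have c1 : 1 < 2 * c by lra.
have := @ae_eventually_not _ _ _ P _ 1 _ mF c1.
have near_F : \forall i \near \oo, (P [set w | (t <= Z i w)%R] <= (1 * i%:R `^ (- (2 * c)))%:E)%E.
  near=> i; rewrite mul1r -expR_y; last by near: i.
  by near: i.
move=> /(_ near_F) H1; apply: filterS2 ae_trunc H1 => w SS' nZ.
near=> i.
have ai : 0 < a i by near: i.
have -> : \sum_(k <- J i) X k w = S' i w by near: i.
have : ~ (t <= Z i w) by near: i.
by move/negP; rewrite -ltNge /Z ltr_pdivrMr.
Unshelve. all: by end_near. Qed.

Lemma block_limsup_ge (delta : R) : 0 < delta -> delta < sigma ->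
  {ae P, forall w, forall m, exists2 i, (m <= i)%N &
    (sigma - 2 * delta) * a i < \sum_(k <- J i) X k w}.
Proof.
move=> d0 ds.
have H := ldp_lower P Z y psi sigma measurable_Z cvg_y mgfZ psi_cvg delta d0 ds.
(* With the conjunct [0 < a i] the complement is either a condition on the truncated block sum or,
   for the finitely many degenerate [i], the whole space; both lie in the sigma-algebra of the
   block. *)
pose F i := [set w | 0 < a i /\ sigma - 2 * delta < Z i w].
have FE i : 0 < a i -> ~` F i = [set w | \sum_(k <- J i) trunc (L i) (X k w) <= (sigma - 2 * delta) * a i].
  move=> ai; apply/seteqP; split => w /=.
    move=> nF; rewrite leNgt; apply/negP => lt; apply: nF; split => //.
    by rewrite /Z ltr_pdivlMr.
  by move=> le [_]; rewrite /Z ltr_pdivlMr// ltNge => /negP; apply.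
have FE0 i : ~ 0 < a i -> F i = set0.
  by move=> na; apply/seteqP; split => // w [].
have sF i : <<s cylinders P X (J i) >> (~` F i).
  have [ai|ai] := pselect (0 < a i).
    rewrite FE//; apply: sigma_cylinders_sum_le; exact: measurable_trunc.
  rewrite FE0// setC0; exact: (@measurableT _ (g_sigma_algebraType _)).
have mF i : measurable (F i).
  rewrite -[F i]setCK; apply: measurableC.
  have := sF i; apply: smallest_sub; first exact: sigma_algebra_measurable.
  by move=> _ [B mB ->]; exact: measurable_cylinder.
have near_F : \forall i \near \oo, (((1 / 2) / i%:R)%:E <= P (F i))%E.
  near=> i.
  have ai : 0 < a i by near: i.
  have i1 : 1 <= i%:R :> R by near: i.
  rewrite (_ : F i = [set w | sigma - 2 * delta < Z i w]); last first.
    by apply/seteqP; split => w /= [].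
  have -> : 1 / 2 / i%:R = expR (- (y i / 2)) / 2 :> R.
    rewrite (_ : y i / 2 = 2^-1 * y i); last by rewrite mulrC.
    rewrite expR_y// mulfV ?pnatr_eq0// powR_inv1; last exact: le_trans i1.
    by rewrite mul1r mulrC.
  by near: i.
have half0 : 0 < 1 / 2 :> R by lra.
have := @ae_infinitely_often _ _ _ P F (1 / 2) m0 mF half0 near_F.
have indF m n : (m0 <= m)%N -> P (\big[setI/setT]_(i <- index_iota m n) ~` F i) =
    (\prod_(i <- index_iota m n) P (~` F i))%E.
  move=> m0m.
  have := blocks_independent P X D indX _ J (fun i => ~` F i) (index_iota m n) [::] (fun=> setT).
  rewrite !cats0 (_ : cylinder P X [::] _ = setT); last by apply/seteqP; split.
  rewrite setIT probability_setT mule1; apply => //.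
  - by move=> i; exact: measurableC.
  - exact: disjJ.
  - by apply/allP => k /flattenP[s /mapP[i _ ->]]; apply/allP.
move=> /(_ indF) H1; apply: filterS2 ae_trunc H1 => w [m1 _ SS'] nZ m.
have [i mi [ai Zi]] := nZ (maxn m m1); exists i.
  by rewrite (leq_trans _ mi)// leq_maxl.
rewrite SS'; last by rewrite /= (leq_trans _ mi)// leq_maxr.
by rewrite -ltr_pdivlMr.
Unshelve. all: by end_near. Qed.

End block_lil.

(** * Windows at the diagonal points *)

Section limsup_criterion.
Context {R : realType}.

(** The thresholds are indexed by [k] so that only countably many almost sure statements have to be
    intersected. Half of the error pays for [1 / (k + 1)], half for the convergence of [a / D]. *)
Lemma limn_esup_eq_of_thresholds (S a D : nat -> R) (sigma c : R) :
  0 <= c -> (\forall i \near \oo, 0 < D i) ->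
  (fun i => a i / D i) @ \oo --> c ->
  (forall k : nat, \forall i \near \oo, S i < (sigma + k.+1%:R^-1) * a i) ->
  (forall k m : nat, exists2 i, (m <= i)%N & (sigma - k.+1%:R^-1) * a i < S i) ->
  limn_esup (fun i => (S i / D i)%:E) = (sigma * c)%:E.
Proof.
move=> c0 D0 caD Sle Sge.
have epsk e : 0 < e -> exists k : nat, k.+1%:R^-1 * c < e / 2.
  move=> e0; have e20 : 0 < e / 2 by lra.
  (* Dividing by [c + 1] avoids a separate case [c = 0]. *)
  have c1 : 0 < c + 1 by lra.
  have /cvgrPdist_lt /(_ _ (divr_gt0 e20 c1)) [k _ hk] := @cvg_harmonic R.
  exists k; have := hk k (leqnn k); rewrite /= sub0r normrN ger0_norm ?invr_ge0//.
  rewrite ltr_pdivlMr// => h; apply: le_lt_trans h.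
  by apply: ler_wpM2l; [rewrite invr_ge0|lra].
have near_lin (s e : R) : 0 < e -> \forall i \near \oo, `|s * c - s * (a i / D i)| < e.
  move=> e0; have : (fun i => s * (a i / D i)) @ \oo --> s * c.
    by apply: cvgM => //; exact: cvg_cst.
  by move=> /cvgrPdist_lt /(_ _ e0).
rewrite limn_esup_lim (cvg_lim _ (@cvg_esups_inf _ _))//; apply/eqP; rewrite eq_le; apply/andP; split.
  apply/lee_addgt0Pr => e e0; have [k hk] := epsk e e0.
  have e20 : 0 < e / 2 by lra.
  have [N _ HN] : \forall i \near \oo, S i / D i <= sigma * c + e.
    near=> i.
    have Di : 0 < D i by near: i.
    have Si : S i < (sigma + k.+1%:R^-1) * a i by near: i.
    have : `|(sigma + k.+1%:R^-1) * c - (sigma + k.+1%:R^-1) * (a i / D i)| < e / 2.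
      by near: i; exact: near_lin.
    rewrite ltr_distlC => /andP[_ h].
    have : S i / D i < (sigma + k.+1%:R^-1) * (a i / D i).
      by rewrite mulrA ltr_pM2r// invr_gt0.
    move: hk h; move: (k.+1%:R^-1) (a i / D i) (S i / D i) => x y z; lra.
  apply: (@le_trans _ _ (esups (fun i => (S i / D i)%:E) N)).
    by apply: ereal_inf_lbound; exists N.
  by apply: ge_ereal_sup => _ [i /= Ni <-]; rewrite -EFinD lee_fin; exact: HN.
apply: le_ereal_inf_tmp => _ [n _ <-].
apply/lee_addgt0Pr => e e0; have [k hk] := epsk e e0.
have e20 : 0 < e / 2 by lra.
have [N _ HN] : \forall i \near \oo, 0 < D i /\ sigma * c - e < (sigma - k.+1%:R^-1) * (a i / D i).
  near=> i; split; first by near: i.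
  have : `|(sigma - k.+1%:R^-1) * c - (sigma - k.+1%:R^-1) * (a i / D i)| < e / 2.
    by near: i; exact: near_lin.
  rewrite ltr_distlC => /andP[h _].
  by move: hk h; move: (k.+1%:R^-1) (a i / D i) => x y; lra.
have [i ni Si] := Sge k (maxn n N).
have [Di hi] : 0 < D i /\ sigma * c - e < (sigma - k.+1%:R^-1) * (a i / D i).
  by apply: HN; rewrite /= (leq_trans _ ni)// leq_maxr.
apply: (@le_trans _ _ ((S i / D i)%:E + e%:E)%E).
  rewrite -EFinD lee_fin -lerBlDr ltW// (lt_trans hi)//.
  by rewrite mulrA ltr_pM2r// invr_gt0.
rewrite leeD2r//; apply: ereal_sup_ubound; exists i => //=.
by rewrite (leq_trans _ ni)// leq_maxl.
Unshelve. all: by end_near. Qed.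

End limsup_criterion.

(** * Windows as lists of indices *)

Section blocks.
Context {R : realType}.

(** The parametrisation is that of [Tsum], so that the two sums agree term by term. *)
Definition block (d : nat) (n k : idx d) : seq (idx d) :=
  [seq [ffun l => (n l + (t l).+1)%N] | t : {ffun 'I_d -> 'I_(\max_(l < d) k l)}
     in [pred t : {ffun 'I_d -> 'I_(\max_(l < d) k l)} | [forall l, (t l < k l)%N]]].

Lemma Tsum_block (T : Type) (d : nat) (X : idx d -> T -> R) (n k : idx d) w :
  Tsum X n k w = \sum_(x <- block d n k) X x w.
Proof. by rewrite /Tsum /block /image_mem big_map big_enum. Qed.

Lemma block_uniq d (n k : idx d) : uniq (block d n k).
Proof.
rewrite /block map_inj_uniq ?enum_uniq// => s t /ffunP st.
apply/ffunP => l; apply/val_inj; have := st l; rewrite !ffunE /= => /eqP.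
by rewrite eqn_add2l eqSS => /eqP.
Qed.

Lemma block_pos d (n k : idx d) : all (@pos_index d) (block d n k).
Proof.
apply/allP => x /mapP[t _ ->]; apply/forallP => l.
by rewrite ffunE addnS.
Qed.

Lemma mem_block d (n k : idx d) (x : idx d) (l : 'I_d) :
  x \in block d n k -> (n l < x l <= n l + k l)%N.
Proof.
move=> /mapP[t]; rewrite mem_enum inE => /forallP tk ->; rewrite ffunE.
by rewrite addnS ltnS leq_addr /= ltn_add2l tk.
Qed.

Lemma size_block d (n k : idx d) (m : nat) : (0 < d)%N -> (forall l, k l = m) ->
  size (block d n k) = (m ^ d)%N.
Proof.
move=> d0 km; rewrite /block size_map -cardE.
have maxm : (\max_(l < d) k l = m)%N.
  apply/anti_leq/andP; split; first by apply/bigmax_leqP => l _; rewrite km.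
  by rewrite -(km (Ordinal d0)); exact: leq_bigmax.
rewrite (@eq_card _ _ {: {ffun 'I_d -> 'I_(\max_(l < d) k l)}}); last first.
  move=> t; rewrite !inE; apply/forallP => l.
  by rewrite km -[ltnRHS]maxm ltn_ord.
by rewrite card_ffun !card_ord maxm.
Qed.

(** One coordinate is enough: the projections of the windows to it are disjoint intervals. *)
Lemma flatten_blocks_uniq d (n k : nat -> idx d) (m0 : nat) (l : 'I_d) :
  (forall i j, (i <= j)%N -> (n i l <= n j l)%N) ->
  (forall i, (m0 <= i)%N -> (n i l + k i l <= n i.+1 l)%N) ->
  forall m p, (m0 <= m)%N -> uniq (flatten (map (fun i => block d (n i) (k i)) (index_iota m p))).
Proof.
move=> ndn gap m p; rewrite /index_iota; move: (p - m)%N => q.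
elim: q m => [//|q IH] m m0m /=.
rewrite cat_uniq block_uniq IH ?(leq_trans m0m)// andbT /=.
apply/hasPn => x /flattenP[_ /mapP[i +  ->] xi]; rewrite mem_iota => /andP[mi _].
apply/negP => /= xm.
have /andP[h1 _] := mem_block _ _ _ _ l xi.
have /andP[_ h2] := mem_block _ _ _ _ l xm.
have := leq_trans h1 (leq_trans h2 (leq_trans (gap m m0m) (ndn _ _ mi))).
by rewrite ltnn.
Qed.

End blocks.

(** * Growth of the diagonal points, the windows and the normalisation *)

Section growth.
Context {R : realType}.
Variables (d : nat) (alpha beta : R).
Hypothesis d1 : (1 <= d)%N.
Hypothesis a0 : 0 < alpha.
Hypothesis a1 : alpha < 1.
Hypothesis b1 : 1 < beta.
Let rho := beta / (1 - alpha).
Let n (i : nat) : nat := Num.truncn ((i%:R : R) `^ rho).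
Let m (i : nat) : nat := Num.truncn ((n i)%:R `^ alpha : R).
Let g := rho * alpha * d%:R.

Let rho1 : 1 < rho.
Proof. by rewrite /rho ltr_pdivlMr; have := a0; have := a1; have := b1; lra. Qed.

Lemma diag_ptE i l : diag_pt d alpha beta i l = n i.
Proof. by rewrite ffunE. Qed.

Lemma pow_diag_ptE i l : pow_idx (diag_pt d alpha beta i) alpha l = m i.
Proof. by rewrite !ffunE. Qed.

Lemma card_diag_pt i : card_idx (diag_pt d alpha beta i) = (n i ^ d)%N.
Proof.
rewrite /card_idx (eq_bigr (fun=> n i)); last by move=> l _; rewrite diag_ptE.
by rewrite prod_nat_const card_ord.
Qed.

Lemma diag_pt_homo i j : (i <= j)%N -> (n i <= n j)%N.
Proof.
move=> ij; apply: le_truncn; apply: ge0_ler_powR; rewrite ?nnegrE ?ler_nat//.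
by have := rho1; lra.
Qed.

Let n_le i : (n i)%:R <= i%:R `^ rho :> R.
Proof. by rewrite truncn_le powR_ge0. Qed.

Let m_le i : (m i)%:R <= (n i)%:R `^ alpha :> R.
Proof. by rewrite truncn_le powR_ge0. Qed.

Lemma powR_ge1 (x e : R) : 1 <= x -> 0 <= e -> 1 <= x `^ e.
Proof. by move=> x1 e0; rewrite -(powRr0 x); exact: ler_powR. Qed.

Lemma truncn_half (x : R) : 1 <= x -> x / 2 <= (Num.truncn x)%:R.
Proof.
move=> x1; have := truncnS_gt x; rewrite -natr1.
have : 1 <= (Num.truncn x)%:R :> R by rewrite ler1n truncn_gt0.
lra.
Qed.

Let near_i1 : \forall i \near \oo, 1 <= (i : nat)%:R :> R.
Proof. by exists 1%N => // i /=; rewrite ler1n. Qed.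

(** Here [beta > 1] enters: [rho (1 - alpha) = beta] makes the window side, at most [i^(rho alpha)],
    of smaller order than [i^(rho - 1)], which bounds the increment of [i^rho] from below. *)
Lemma diag_block_gap : exists m0, forall i, (m0 <= i)%N -> (n i + m i <= n i.+1)%N.
Proof.
have r1 := rho1.
have e0 : 0 < rho - 1 - rho * alpha.
  have -> : rho - 1 - rho * alpha = rho * (1 - alpha) - 1 by ring.
  by rewrite /rho divfK; have := a1; have := b1; lra.
have half : 0 < 1 / 2 :> R by lra.
have /cvgrPdist_lt /(_ _ half) H := @cvg_powRN0 R _ e0.
have [m0 _ Hm0] : \forall i \near \oo, (n i + m i <= n i.+1)%N.
  near=> i.
  have i1 : 1 <= i%:R :> R by near: i.
  have i0 : 0 < i%:R :> R by lra.
  have : `|0 - i%:R `^ (- (rho - 1 - rho * alpha))| < 1 / 2 :> R by near: i.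
  rewrite sub0r normrN ger0_norm ?powR_ge0// => small.
  (* The left side is an integer, so it may be compared with the power before truncation. *)
  rewrite /n truncn_ge_nat ?powR_ge0// natrD.
  have mi : (m i)%:R <= i%:R `^ (rho * alpha) :> R.
    apply: (le_trans (m_le i)); rewrite powRrM.
    by apply: ge0_ler_powR; rewrite ?nnegrE ?powR_ge0//; apply: ltW.
  have E1 : i%:R `^ (rho * alpha) <= i%:R `^ (rho - 1) / 2 :> R.
    have -> : i%:R `^ (rho * alpha) = i%:R `^ (rho - 1) * i%:R `^ (- (rho - 1 - rho * alpha)) :> R.
      rewrite -powRD; first by congr (_ `^ _); ring.
      by apply/implyP => _; rewrite gt_eqF.
    by apply: ler_wpM2l; [exact: powR_ge0|lra].
  have E2 : i%:R `^ rho + i%:R `^ (rho - 1) <= i.+1%:R `^ rho :> R.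
    have -> : i.+1%:R `^ rho = i.+1%:R * i.+1%:R `^ (rho - 1) :> R.
      by rewrite mulr_powRB1//; lra.
    have -> : i%:R `^ rho = i%:R * i%:R `^ (rho - 1) :> R.
      by rewrite mulr_powRB1//; lra.
    rewrite -{2}[i%:R `^ (rho - 1)]mul1r -mulrDl natr1.
    apply: ler_wpM2l => //; apply: ge0_ler_powR; rewrite ?nnegrE ?ler_nat//; lra.
  have := n_le i; have := powR_ge0 (i%:R : R) (rho - 1); lra.
by exists m0 => i; exact: Hm0.
Unshelve. all: by end_near. Qed.

Let n_half i : 1 <= i%:R :> R -> i%:R `^ rho / 2 <= (n i)%:R :> R.
Proof.
move=> i1; apply: truncn_half.
by apply: powR_ge1 => //; have := rho1; lra.
Qed.

Let n_ge1 i : 1 <= i%:R :> R -> 1 <= (n i)%:R :> R.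
Proof.
move=> i1; rewrite ler1n truncn_gt0.
by apply: powR_ge1 => //; have := rho1; lra.
Qed.

Lemma size_block_le : \forall i \near \oo, (m i ^ d)%:R <= i%:R `^ g :> R.
Proof.
near=> i.
have i1 : 1 <= i%:R :> R by near: i.
rewrite natrX /g 2!powRrM powR_mulrn ?powR_ge0//.
rewrite lerXn2r ?nnegrE ?powR_ge0//; apply: (le_trans (m_le i)).
by apply: ge0_ler_powR; rewrite ?nnegrE ?powR_ge0//; exact: ltW.
Unshelve. all: by end_near. Qed.

(** Each of the two roundings costs a factor of at most 2: the first becomes [2^alpha] under the
    power, the second stays, and both are raised to the power [d]. *)
Lemma size_block_ge : \forall i \near \oo,
  (2 `^ (- alpha) / 2) ^+ d * i%:R `^ g <= (m i ^ d)%:R :> R.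
Proof.
near=> i.
have i1 : 1 <= i%:R :> R by near: i.
rewrite natrX /g 2!powRrM powR_mulrn ?powR_ge0// -exprMn.
rewrite lerXn2r ?nnegrE ?mulr_ge0 ?powR_ge0//.
have na1 : 1 <= (n i)%:R `^ alpha :> R.
  by apply: powR_ge1; [exact: n_ge1|exact: ltW].
apply: le_trans (truncn_half _ na1).
rewrite mulrAC ler_pM2r// powRN mulrC ler_pdivrMr ?powR_gt0// -powRM//.
apply: ge0_ler_powR; rewrite ?nnegrE ?powR_ge0//; first exact: ltW.
by have := n_half i i1; lra.
Unshelve. all: by end_near. Qed.

Lemma cvg_truncn_ratio (x : nat -> R) : x @ \oo --> +oo ->
  (fun i => (Num.truncn (x i))%:R / x i) @ \oo --> (1 : R).
Proof.
move=> xoo; apply/cvgrPdist_le => e e0.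
have /cvgryPge /(_ (Num.max 1 e^-1)) H := xoo.
near=> i; have : Num.max 1 e^-1 <= x i by near: i.
rewrite ge_max => /andP[x1 xe].
have x0 : 0 < x i by lra.
have := truncnS_gt (x i); rewrite -natr1 => h1.
have h2 : (Num.truncn (x i))%:R <= x i by rewrite truncn_le ltW.
have -> : 1 - (Num.truncn (x i))%:R / x i = (x i - (Num.truncn (x i))%:R) / x i.
  by rewrite mulrBl divff// gt_eqF.
rewrite ger0_norm; last by apply: divr_ge0; lra.
rewrite ler_pdivrMr//; apply: (@le_trans _ _ 1); first lra.
by rewrite -ler_pdivrMl// mulr1.
Unshelve. all: by end_near. Qed.

Lemma cvgy_powR (x : nat -> R) (e : R) : 0 < e -> x @ \oo --> +oo ->
  (fun i => x i `^ e) @ \oo --> +oo.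
Proof.
move=> e0 xoo; apply/cvgryPge => A.
have /cvgryPge /(_ (Num.max 1 A `^ e^-1)) H := xoo.
near=> i; have h : Num.max 1 A `^ e^-1 <= x i by near: i.
have A0 : 0 <= Num.max 1 A by rewrite le_max ler01.
apply: (@le_trans _ _ ((Num.max 1 A `^ e^-1) `^ e)).
  by rewrite -powRrM mulVf ?gt_eqF// powRr1// le_max lexx orbT.
apply: ge0_ler_powR => //; rewrite ?nnegrE ?powR_ge0//; first exact: ltW.
by apply: le_trans h; exact: powR_ge0.
Unshelve. all: by end_near. Qed.

Let cvg_n : (fun i => (n i)%:R : R) @ \oo --> +oo.
Proof.
apply/cvgryPge => A; have := cvgy_powR (fun i => i%:R) rho.
have r0 : 0 < rho by have := rho1; lra.
move=> /(_ r0 (@cvgr_idn R)) /cvgryPge /(_ (A * 2)) H.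
near=> i.
have i1 : 1 <= i%:R :> R by near: i.
apply: le_trans (n_half i i1); rewrite ler_pdivlMr//; near: i; exact: H.
Unshelve. all: by end_near. Qed.

(** [ln (n i)] lies between [rho ln i - ln 2] and [rho ln i]. *)
Let cvg_ln_ratio : (fun i => ln (n i)%:R / ln i%:R : R) @ \oo --> rho.
Proof.
apply/cvgrPdist_le => e e0.
have /cvgryPge /(_ (Num.max 1 (ln 2 / e))) H := @cvg_ln_nat R.
near=> i.
have i1 : 1 <= i%:R :> R by near: i.
have : Num.max 1 (ln 2 / e) <= ln i%:R by near: i.
rewrite ge_max => /andP[l1 le].
have l0 : 0 < ln i%:R :> R by lra.
have ni0 : 0 < (n i)%:R :> R by apply: lt_le_trans ltr01 (n_ge1 i i1).
have ir0 : 0 < i%:R `^ rho :> R by rewrite powR_gt0//; lra.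
have up : ln (n i)%:R <= rho * ln i%:R :> R.
  by rewrite -ln_powR ler_ln ?posrE.
have lo : rho * ln i%:R - ln 2 <= ln (n i)%:R :> R.
  by rewrite -ln_powR -ln_div ?posrE// ler_ln ?posrE ?divr_gt0//; exact: n_half.
have -> : rho - ln (n i)%:R / ln i%:R = (rho * ln i%:R - ln (n i)%:R) / ln i%:R.
  by rewrite mulrBl mulfK// gt_eqF.
rewrite ger0_norm; last by apply: divr_ge0; lra.
rewrite ler_pdivrMr//; move: le; rewrite ler_pdivrMr// (mulrC _ e) => le.
lra.
Unshelve. all: by end_near. Qed.

Let scale i : R := Num.sqrt ((m i ^ d)%:R * (2 * ln i%:R)).
Let denom i : R := Num.sqrt (2 * ((n i ^ d)%:R `^ alpha) * ln (n i ^ d)%:R).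

Lemma near_denom_gt0 : \forall i \near \oo, 0 < denom i.
Proof.
have /cvgryPge /(_ 2) H := cvg_n.
near=> i.
have n2 : 2 <= (n i)%:R :> R by near: i.
have nd : 1 < (n i ^ d)%:R :> R.
  have dn0 : d != 0%N by rewrite -lt0n.
  by rewrite natrX exprn_egt1// (lt_le_trans _ n2)// ltr1n.
rewrite sqrtr_gt0 mulr_gt0// ?ln_gt0//.
by rewrite mulr_gt0// powR_gt0//; lra.
Unshelve. all: by end_near. Qed.

(** The squared ratio is [(m / n^alpha)^d] over [d ln n / ln i], with limit
    [1 / (d rho) = (1 - alpha) / (d beta)]. *)
Lemma cvg_scale_denom :
  (fun i => scale i / denom i) @ \oo --> Num.sqrt ((1 - alpha) / (d%:R * beta)).
Proof.
have rho0 : 0 < rho by have := rho1; lra.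
have d0 : 0 < d%:R :> R by rewrite ltr0n.
have cm : (fun i => ((m i)%:R / (n i)%:R `^ alpha) ^+ d : R) @ \oo --> (1 : R).
  have cm1 : (fun i => (m i)%:R / (n i)%:R `^ alpha : R) @ \oo --> (1 : R).
    by apply: cvg_truncn_ratio; exact: cvgy_powR.
  have := continuous_cvg _ (@exprn_continuous R d 1) cm1; rewrite expr1n => H; exact: H.
have E : \forall i \near \oo,
   Num.sqrt (((m i)%:R / (n i)%:R `^ alpha) ^+ d * (d%:R * (ln (n i)%:R / ln i%:R))^-1)
   = scale i / denom i.
  have /cvgryPge /(_ 2) H := cvg_n.
  have /cvgryPge /(_ 1) H2 := @cvg_ln_nat R.
  near=> i.
  have n2 : 2 <= (n i)%:R :> R by near: i.
  have l1 : 1 <= ln i%:R :> R by near: i.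
  have l0 : 0 < ln i%:R :> R by lra.
  have n0 : 0 < (n i)%:R :> R by lra.
  have ln0 : 0 < ln (n i)%:R :> R by apply: ln_gt0; lra.
  have na0 : 0 < (n i)%:R `^ alpha :> R by exact: powR_gt0.
  have nd0 : 0 < ((n i)%:R `^ alpha) ^+ d :> R by exact: exprn_gt0.
  rewrite /scale /denom -sqrtrV; last first.
    by rewrite mulr_ge0 ?ln_ge0 ?mulr_ge0 ?powR_ge0// natrX exprn_ege1//; lra.
  rewrite -sqrtrM; last by rewrite !mulr_ge0// ltW.
  congr Num.sqrt.
  have npow : ((n i)%:R ^+ d) `^ alpha = ((n i)%:R `^ alpha) ^+ d :> R.
    by rewrite -powR_mulrn ?ler0n// -powRrM mulrC powRrM powR_mulrn ?powR_ge0.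
  rewrite !natrX lnXn// -(mulr_natr (ln _) d) npow exprMn exprVn.
  by field; rewrite !gt_eqF.
apply: cvg_trans (near_eq_cvg E) _.
apply: (continuous_cvg _ (@sqrt_continuous R _)).
have -> : (1 - alpha) / (d%:R * beta) = 1 * (d%:R * rho)^-1.
  by rewrite /rho; field; rewrite !gt_eqF//; have := a1; have := b1; lra.
apply: cvgM => //; apply: cvgV; first by rewrite gt_eqF// mulr_gt0.
by apply: cvgM => //; exact: cvg_cst.
Unshelve. all: by end_near. Qed.

End growth.

(** * From the logarithmic moment to a power moment *)

Section moment.
Context {R : realType} {dt : measure_display} {T : measurableType dt}.
Variable (P : probability T R).

Lemma logp_ge1 (x : R) : 1 <= logp x.
Proof. by rewrite /logp le_max lexx orbT. Qed.

(** For [x > 1] the logarithm is at most a multiple of [x^(alpha tau)], so [logp x ^ (1 / alpha)]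
    costs at most the spare power [x^tau]. The summand 1 covers [x <= 1], and [logp x >= 1] reduces
    the claim to [e = - 1 / alpha]. *)
Lemma powR_le_logp (alpha tau e p x : R) : 0 < alpha -> 0 < tau ->
  p + tau = 2 / alpha -> - alpha^-1 <= e -> 0 <= p -> 0 <= x ->
  x `^ p <= 1 + (Num.max 1 (alpha * tau)^-1) `^ alpha^-1 * (x `^ (2 / alpha) * logp x `^ e).
Proof.
move=> a0 t0 ptau ae p0 x0; set K := Num.max _ _.
have K1 : 1 <= K by rewrite /K le_max lexx.
have at0 : 0 < alpha * tau by exact: mulr_gt0.
have l1 := logp_ge1 x.
have [x1|x1] := leP x 1.
  apply: (@le_trans _ _ 1); last by rewrite lerDl !mulr_ge0 ?powR_ge0.
  rewrite -[leRHS](_ : (1 : R) `^ p = 1); last by rewrite powR1.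
  by apply: ge0_ler_powR; rewrite ?nnegrE.
have lK : logp x <= K * x `^ (alpha * tau).
  have xat : 1 <= x `^ (alpha * tau) by apply: powR_ge1; exact: ltW.
  rewrite /logp ge_max; apply/andP; split.
    apply: (le_trans (ln_le_powR _ _ (ltW x1) at0)).
    by rewrite mulrC; apply: ler_wpM2r; [exact: powR_ge0|rewrite /K le_max lexx orbT].
  by rewrite -[leLHS]mulr1; apply: ler_pM.
have lKa : logp x `^ alpha^-1 <= K `^ alpha^-1 * x `^ tau.
  have -> : x `^ tau = (x `^ (alpha * tau)) `^ alpha^-1.
    by rewrite -powRrM mulrAC divff ?mul1r// gt_eqF.
  rewrite -powRM ?powR_ge0//; last lra.
  apply: ge0_ler_powR; rewrite ?nnegrE ?mulr_ge0 ?powR_ge0//; [|lra|lra].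
  by rewrite invr_ge0 ltW.
apply: (@le_trans _ _ (K `^ alpha^-1 * (x `^ (2 / alpha) * logp x `^ (- alpha^-1)))).
  rewrite -ptau powRD; last by apply/implyP => _; rewrite gt_eqF//; lra.
  rewrite powRN.
  have L0 : 0 < logp x `^ alpha^-1 by apply: powR_gt0; lra.
  rewrite !mulrA ler_pdivlMr// -!mulrA mulrCA.
  by apply: ler_wpM2l; [exact: powR_ge0|].
rewrite -[leLHS]add0r; apply: lerD => //.
apply: ler_wpM2l; first exact: powR_ge0.
apply: ler_wpM2l; first exact: powR_ge0.
exact: ler_powR.
Qed.

Lemma integrable_powR_of_logp (X : {RV P >-> R}) (alpha e p : R) : 0 < alpha -> 0 <= p ->
  p < 2 / alpha -> - alpha^-1 <= e ->
  (\int[P]_w ((`|X w| `^ (2 / alpha)) * (logp `|X w|) `^ e)%:E < +oo)%E ->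
  P.-integrable setT (EFin \o (fun w => `|X w| `^ p)).
Proof.
move=> a0 p0 p2a ae fin.
pose C := (Num.max 1 (alpha * (2 / alpha - p))^-1) `^ alpha^-1.
pose H w := (`|X w| `^ (2 / alpha)) * (logp `|X w|) `^ e.
have mX : measurable_fun setT (fun w => `|X w|) by exact: measurableT_comp.
have mH : measurable_fun setT H.
  apply: measurable_funM.
    exact: (measurableT_comp (measurable_powR _)).
  apply: (measurableT_comp (measurable_powR _)).
  apply: measurable_maxr => //.
  exact: (measurableT_comp (@measurable_ln R)).
have H0 w : 0 <= H w by rewrite mulr_ge0 ?powR_ge0.
have iH : P.-integrable setT (EFin \o H).
  apply/integrableP; split; first exact/measurable_EFinP.
  by under eq_integral do rewrite /= ger0_norm//.
have i1 : P.-integrable setT (EFin \o (fun=> 1 : R)).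
  exact: finite_measure_integrable_cst.
have iCH : P.-integrable setT (EFin \o (fun w => 1 + C * H w)).
  apply: eq_integrable (integrableD measurableT i1 (integrableZl measurableT C iH)) => //.
apply: (le_integrable _ _ _ iCH) => //.
  by apply/measurable_EFinP; exact: (measurableT_comp (measurable_powR _)).
move=> w _ /=.
have CH0 : 0 <= 1 + C * H w by rewrite addr_ge0// mulr_ge0// powR_ge0.
rewrite lee_fin (ger0_norm (powR_ge0 _ _)) (ger0_norm CH0).
apply: powR_le_logp => //; [by rewrite subr_gt0|by rewrite addrC subrK].
Qed.

End moment.

(** * One-sided bounds along the diagonal windows *)

Section one_sided.
Context {R : realType} {dt : measure_display} {T : measurableType dt}.
Variables (P : probability T R) (d : nat) (alpha beta sigma : R).
Hypothesis d1 : (1 <= d)%N.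
Hypothesis a0 : 0 < alpha.
Hypothesis a1 : alpha < 1.
Hypothesis b1 : 1 < beta.
Hypothesis s0 : 0 <= sigma.
Let rho := beta / (1 - alpha).
Let g := rho * alpha * d%:R.
Let p := ((1 + g) / (g / 2) + 2 / alpha) / 2.
Let n i := diag_pt d alpha beta i.
Let J i := block d (n i) (pow_idx (n i) alpha).
Let scale i : R := Num.sqrt ((size (J i))%:R * (2 * ln i%:R)).

Let g0 : 0 < g.
Proof.
rewrite !mulr_gt0 ?ltr0n ?invr_gt0// ?subr_gt0//.
by have := b1; lra.
Qed.

(** The lower end is [2 + 2 / g], which is below [2 / alpha] exactly when [g > alpha / (1 - alpha)];
    indeed [g] is that quantity times [beta d > 1]. [p] is the midpoint. *)
Lemma moment_exponent_lt : (1 + g) / (g / 2) < p < 2 / alpha.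
Proof.
have h : (1 + g) / (g / 2) < 2 / alpha.
  have a10 : 0 < 1 - alpha by rewrite subr_gt0.
  rewrite ltr_pdivrMr ?divr_gt0// mulrAC ltr_pdivlMr//.
  have -> : 2 * (g / 2) = g by field.
  have -> : g = alpha / (1 - alpha) * (beta * d%:R).
    by rewrite /g /rho; field; rewrite gt_eqF.
  have db : 1 < beta * d%:R.
    by rewrite (lt_le_trans b1)// ler_peMr ?ler1n// (le_trans ler01)// ltW.
  set c := alpha / (1 - alpha).
  have h1 : c * (beta * d%:R) * (1 - alpha) = alpha * (beta * d%:R).
    by rewrite mulrAC /c divfK// gt_eqF.
  have h2 : alpha < alpha * (beta * d%:R) by rewrite ltr_pMr.
  lra.
by rewrite /p !(midf_lt h).
Qed.

Let pg : 1 + g < p * (g / 2).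
Proof. by have /andP[+ _] := moment_exponent_lt; rewrite ltr_pdivrMr// divr_gt0. Qed.

Lemma moment_exponent_gt2 : 2 < p.
Proof.
have /andP[+ _] := moment_exponent_lt; apply: lt_trans.
by rewrite ltr_pdivlMr ?divr_gt0//; have := g0; lra.
Qed.

(** Gathers hypotheses that are stable under negation of the field, so that bounds for [X] also
    serve for [- X]. *)
Definition regular_field (X : idx d -> {RV P >-> R}) (X0 : {RV P >-> R}) :=
  [/\ iid_copies X X0, P.-integrable setT (EFin \o X0),
   P.-integrable setT (EFin \o (fun w => X0 w ^+ 2)),
   P.-integrable setT (EFin \o (fun w => `|X0 w| `^ p)) &
   \int[P]_w X0 w = 0 /\ \int[P]_w (X0 w ^+ 2) = sigma ^+ 2].

Lemma regular_fieldN (X : idx d -> {RV P >-> R}) (X0 : {RV P >-> R}) :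
  regular_field X X0 ->
  regular_field (fun k => (- (X k : {mfun T >-> R}))%R : {RV P >-> R})
    ((- (X0 : {mfun T >-> R}))%R : {RV P >-> R}).
Proof.
have mN (B : set R) : measurable B -> measurable ((-%R : R -> R) @^-1` B).
  by move=> mB; rewrite -[X in measurable X]setTI; apply: (measurable_funN (@measurable_id _ R setT)).
move=> [[idX indX] iX iX2 iXp [EX EX2]]; split.
- split => [k Dk B mB|s us Ds B mB].
    exact: (idX k Dk _ (mN _ mB)).
  exact: (indX s us Ds (fun k => -%R @^-1` B k) (fun k => mN _ (mB k))).
- by apply: eq_integrable (integrableN iX).
- by apply: eq_integrable iX2 => // w _ /=; rewrite sqrrN.
- by apply: eq_integrable iXp => // w _ /=; rewrite normrN.
- split; last first.
    by rewrite -EX2; apply: eq_Rintegral => w _ /=; rewrite sqrrN.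
  rewrite (_ : (fun w => _) = (fun w => - 1 * X0 w)); last first.
    by apply/funext => w /=; rewrite mulN1r.
  by rewrite RintegralZl// EX mulr0.
Qed.

Lemma size_diag_block i : size (J i) = (Num.truncn ((Num.truncn ((i%:R : R) `^ rho))%:R `^ alpha : R) ^ d)%N.
Proof. by apply: size_block => // l; exact: pow_diag_ptE. Qed.

Let c0 : R := (2 `^ (- alpha) / 2) ^+ d.
Let c00 : 0 < c0.
Proof. by rewrite /c0 exprn_gt0// divr_gt0// powR_gt0. Qed.
Let size_le : \forall i \near \oo, (size (J i))%:R <= i%:R `^ g.
Proof. by apply: filterS (size_block_le d alpha beta a0) => i; rewrite size_diag_block. Qed.
Let size_ge : \forall i \near \oo, c0 * i%:R `^ g <= (size (J i))%:R.
Proof. by apply: filterS (size_block_ge d alpha beta a0 a1 b1) => i; rewrite size_diag_block. Qed.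
Let DJ i : all (@pos_index d) (J i). Proof. exact: block_pos. Qed.
Let uJ i : uniq (J i). Proof. exact: block_uniq. Qed.

Lemma field_limsup_le (X : idx d -> {RV P >-> R}) (X0 : {RV P >-> R}) :
  regular_field X X0 ->
  {ae P, forall w, forall k : nat, \forall i \near \oo,
    \sum_(x <- J i) X x w < (sigma + k.+1%:R^-1) * scale i}.
Proof.
move=> [[idX indX] iX iX2 iXp [EX EX2]]; apply: ae_foralln => k.
apply: (block_limsup_le P X (@pos_index d) X0 indX idX sigma p moment_exponent_gt2 iX iX2 iXp EX EX2
  J g c0 DJ uJ g0 c00 size_le size_ge pg) => //.
by rewrite ltrDl invr_gt0.
Qed.

Lemma field_limsup_ge (X : idx d -> {RV P >-> R}) (X0 : {RV P >-> R}) : 0 < sigma ->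
  regular_field X X0 ->
  {ae P, forall w, forall k m : nat, exists2 i, (m <= i)%N &
    (sigma - k.+1%:R^-1) * scale i < \sum_(x <- J i) X x w}.
Proof.
move=> sp [[idX indX] iX iX2 iXp [EX EX2]]; apply: ae_foralln => k.
have [m0 gap] := diag_block_gap alpha beta a0 a1 b1.
have disjJ m q : (m0 <= m)%N -> uniq (flatten [seq J i | i <- index_iota m q]).
  apply: (flatten_blocks_uniq d n (fun i => pow_idx (n i) alpha) m0 (Ordinal d1)).
    by move=> i j ij; rewrite /n !diag_ptE; exact: diag_pt_homo.
  by move=> i mi; rewrite /n pow_diag_ptE !diag_ptE; exact: gap.
(* The first term ensures [delta < sigma], the second [2 delta <= 1 / (k + 1)]. *)
pose delta := Num.min (sigma / 2) (k.+1%:R^-1 / 2).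
have k0 : 0 < k.+1%:R^-1 :> R by rewrite invr_gt0.
have d0 : 0 < delta by rewrite lt_min !divr_gt0.
have ds : delta < sigma.
  by rewrite /delta gt_min ltr_pdivrMr// ltr_pMr// ltr1n.
have dk : delta <= k.+1%:R^-1 / 2 by rewrite /delta ge_min lexx orbT.
apply: filterS (block_limsup_ge P X (@pos_index d) X0 indX idX sigma p moment_exponent_gt2 iX iX2 iXp EX EX2
  J m0 g c0 DJ uJ disjJ g0 c00 size_le size_ge pg delta d0 ds) => w H m.
have [i mi lt] := H m; exists i => //; apply: le_lt_trans lt.
apply: ler_wpM2r; first exact: sqrtr_ge0.
by rewrite lerD2l lerN2 mulrC -ler_pdivlMr.
Qed.

(* For sigma = 0 the lower bound comes from the upper bound for -X. *)
Lemma field_limsup_ge0 (X : idx d -> {RV P >-> R}) (X0 : {RV P >-> R}) :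
  regular_field X X0 ->
  {ae P, forall w, forall k m : nat, exists2 i, (m <= i)%N &
    (sigma - k.+1%:R^-1) * scale i < \sum_(x <- J i) X x w}.
Proof.
move=> reg; have [sp|] := ltP 0 sigma; first exact: field_limsup_ge reg.
move=> sn; have s00 : sigma = 0 by apply/eqP; rewrite eq_le sn.
apply: filterS (field_limsup_le _ _ (regular_fieldN _ _ reg)) => w H k m.
have [N _ HN] := H k; exists (maxn m N); first exact: leq_maxl.
have := HN _ (leq_maxr m N); rewrite /= sumrN s00 add0r sub0r mulNr => h.
by rewrite ltrNl.
Qed.

End one_sided.

(** * Upper and lower limits of the normalised window sums *)

Theorem theorem6p2 (R : realType) (dt : measure_display) (T : measurableType dt)
    (P : probability T R) (d : nat) (alpha beta sigma : R)
    (X : idx d -> {RV P >-> R}) (X0 : {RV P >-> R}) :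
  (1 <= d)%N -> 0 < alpha -> alpha < 1 -> 1 < beta ->
  iid_copies X X0 ->
  (X0 : T -> R) \in Lfun P 2%:E ->
  ('E_P[X0] = 0)%E ->
  0 <= sigma -> 'V_P[X0]%E = ((sigma ^+ 2)%R)%:E ->
  (\int[P]_w ((`|X0 w| `^ (2 / alpha)) *
              (logp `|X0 w|) `^ (d%:R - 1 - 1 / alpha))%:E < +oo)%E ->
  {ae P, forall w,
    limn_esup (fun i => (ratioT (fun k w => X k w) alpha beta i w)%:E)
      = (sigma * Num.sqrt ((1 - alpha) / (d%:R * beta)))%:E /\
    limn_einf (fun i => (ratioT (fun k w => X k w) alpha beta i w)%:E)
      = (- (sigma * Num.sqrt ((1 - alpha) / (d%:R * beta))))%:E}.
Proof.
move=> d1 a0 a1 b1 iid L2 EX s0 VX mom.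
have reg : regular_field P d alpha beta sigma X X0.
  have /andP[_ pu] := moment_exponent_lt d alpha beta d1 a0 a1 b1.
  have b0 : 0 < 1 - alpha by rewrite subr_gt0.
  have L1 : (X0 : T -> R) \in Lfun P 1 by apply: Lfun_subset12 L2; exact: fin_num_measure.
  have iX : P.-integrable setT (EFin \o X0) by exact/Lfun1_integrable.
  have iX2 := Lfun2_integrable_sqr L2.
  split => //.
    apply: integrable_powR_of_logp mom => //.
    - by apply: le_trans (ltW (moment_exponent_gt2 d alpha beta d1 a0 a1 b1)).
    (* The logarithmic exponent is at least [- 1 / alpha] because [d >= 1]. *)
    - by rewrite mul1r -[leLHS]add0r lerD2r subr_ge0 ler1n.
  split.
    by rewrite /Rintegral -expectation_def EX.
  move: VX; rewrite varianceE// EX expe2 mul0e sube0 => VX.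
  by rewrite /Rintegral -[RHS]/(fine (sigma ^+ 2)%:E) -VX unlock.
have regN := regular_fieldN _ _ _ _ _ _ _ reg.
have Hle := field_limsup_le P d alpha beta sigma d1 a0 a1 b1 s0 _ _ reg.
have Hge := field_limsup_ge0 P d alpha beta sigma d1 a0 a1 b1 s0 _ _ reg.
have HleN := field_limsup_le P d alpha beta sigma d1 a0 a1 b1 s0 _ _ regN.
have HgeN := field_limsup_ge0 P d alpha beta sigma d1 a0 a1 b1 s0 _ _ regN.
apply: filterS2 (filterI Hle Hge) (filterI HleN HgeN) => w [le ge] [leN geN].
set c := Num.sqrt _.
pose J i := block d (diag_pt d alpha beta i) (pow_idx (diag_pt d alpha beta i) alpha).
pose D i : R := let n := diag_pt d alpha beta i in
  Num.sqrt (2 * ((card_idx n)%:R `^ alpha) * ln (card_idx n)%:R).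
pose scale i : R := Num.sqrt ((size (J i))%:R * (2 * ln i%:R)).
have D0 : \forall i \near \oo, 0 < D i.
  by apply: filterS (near_denom_gt0 d alpha beta d1 a0 a1 b1) => i; rewrite /D /= card_diag_pt.
have sD : (fun i => scale i / D i) @ \oo --> c.
  apply: cvg_trans (cvg_scale_denom d alpha beta d1 a0 a1 b1).
  apply: near_eq_cvg; apply: nearW => i.
  by rewrite /scale /D /J size_diag_block//= card_diag_pt.
have limsupE (S : nat -> R) := limn_esup_eq_of_thresholds S scale D sigma c (sqrtr_ge0 _) D0 sD.
have ratioE i : ratioT (fun k w => X k w) alpha beta i w = (\sum_(x <- J i) X x w) / D i.
  by rewrite /ratioT Tsum_block.
split.
  by under eq_fun do rewrite ratioE; exact: limsupE.
(* The lower limit is minus the upper limit of the opposite sequence, whose terms are the window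
   sums of [- X]. *)
rewrite /limn_einf EFinN; congr (- _)%E.
under eq_fun do rewrite ratioE -EFinN -mulNr -sumrN.
exact: limsupE.
Qed.
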